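(* Let $\Gamma$ be a finite group and let $\lambda,\mu,\nu\in\mathcal P(\Gamma_* )$. Then: (1) there is a unique polynomial $f_{\lambda\mu}^{\nu}(x)$ such that $f_{\lambda\mu}^{\nu}(n)=a_{\lambda\mu}^{\nu}(n)$ for all positive integers $n$ (where, for those $n<\|\nu\|+\ell(\nu(c^0))$, for which $K_\nu(n)=0$ and the coefficient $a_{\lambda\mu}^\nu(n)$ is arbitrary, $a_{\lambda\mu}^\nu(n)$ is understood to be chosen equal to the value of the polynomial $f_{\lambda\mu}^\nu$ at $n$; so the condition is that $f_{\lambda\mu}^\nu(n)=a_{\lambda\mu}^\nu(n)$ for all $n\ge \|\nu\|+\ell(\nu(c^0))$); (2) the polynomial $f_{\lambda\mu}^{\nu}(x)$ is a constant if $\|\nu\|=\|\lambda\|+\|\mu\|$.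
   Context: $\Gamma_*$ is the set of conjugacy classes of $\Gamma$, and $c^0=\{1\}$ is the identity class. $S_n$ acts on $\Gamma^n$ by $\sigma(g_1,\dots,g_n)=(g_{\sigma^{-1}(1)},\dots,g_{\sigma^{-1}(n)})$, and the wreath product is $\Gamma_n=\Gamma^n\rtimes S_n$ with $(g,\sigma)(h,\tau)=(g\,\sigma(h),\sigma\tau)$. $\Gamma_n$ embeds in $\Gamma_{n+1}$ as $\Gamma_n\times 1$, and $\Gamma_\infty=\bigcup_{n\ge1}\Gamma_n$. For $x=(g,\sigma)$ and a cycle $(i_1 i_2\cdots i_k)$ of $\sigma$ (fixed points are 1-cycles), the cycle-product is $g_{i_k}g_{i_{k-1}}\cdots g_{i_1}\in\Gamma$, well defined up to conjugacy. $\mathcal P(\Gamma_* )$ is the set of functions $\lambda=(\lambda(c))_{c\in\Gamma_*}$ with values in partitions; $\|\lambda\|=\sum_c|\lambda(c)|$, and $\ell(\cdot)$ denotes the number of parts of a partition. The type $\rho$ of $x\in\Gamma_n$ is defined by: the number of parts of $\rho(c)$ equal to $i$ is the number of $i$-cycles of $\sigma$ with cycle-product in $c$. The modified type $\lambda$ of $x$ is: $\lambda(c)=\rho(c)$ for $c\ne c^0$, and $\lambda(c^0)=(\rho_1-1,\dots,\rho_r-1)$ (zeros discarded) if $\rho(c^0)=(\rho_1,\dots,\rho_r)$. It does not change under $\Gamma_n\subset\Gamma_{n+1}$, and two elements of $\Gamma_\infty$ are conjugate iff their modified types coincide. $R_\mathbb{Z}(\Gamma_n)$ is the center of $\mathbb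 Z[\Gamma_n]$. $K_\lambda(n)\in R_{\mathbb Z}(\Gamma_n)$ is the sum of all elements of $\Gamma_n$ of modified type $\lambda$; it is nonzero iff $\|\lambda\|+\ell(\lambda(c^0))\le n$, and the nonzero $K_\lambda(n)$ form a $\mathbb Z$-basis of $R_\mathbb{Z}(\Gamma_n)$. The structure constants $a_{\lambda\mu}^\nu(n)$ are defined by $K_\lambda(n)K_\mu(n)=\sum_\nu a_{\lambda\mu}^\nu(n)K_\nu(n)$; they are uniquely determined for $n\ge\|\nu\|+\ell(\nu(c^0))$. *)

(* Defs.v *)
From HB Require Import structures.
From mathcomp Require Import all_boot all_order all_algebra all_fingroup.
From mathcomp Require Import boolp classical_sets fsbigop.

Set Implicit Arguments.
Unset Strict Implicit.
Unset Printing Implicit Defensive.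

Import GRing.Theory.

Section IntegralGroupRing.
Local Open Scope ring_scope.

Definition group_ring (gT : finGroupType) : Type := {ffun gT -> int}.

Variable gT : finGroupType.

HB.instance Definition _ := GRing.Zmodule.copy (group_ring gT) {ffun gT -> int}.

Definition gr_elt (x : gT) : group_ring gT := [ffun y => (y == x)%:R].

Definition gr_mul (a b : group_ring gT) : group_ring gT :=
  [ffun x => \sum_(y : gT) a y * b (y^-1 * x)%g].

Fact gr_mulA : associative gr_mul.
Proof.
move=> a b c; apply/ffunP=> x; rewrite !ffunE.
under eq_bigr => y _ do rewrite ffunE big_distrr /=.
under [RHS]eq_bigr => z _ do rewrite ffunE big_distrl /=.
rewrite [RHS]exchange_big /=; apply: eq_bigr => y _.
rewrite [RHS](reindex_inj (mulgI y)) /=; apply: eq_bigr => z _.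
by rewrite mulKg invMg mulgA mulrA.
Qed.

Fact gr_mul1 : left_id (gr_elt 1%g) gr_mul.
Proof.
move=> a; apply/ffunP=> x; rewrite !ffunE (bigD1 1%g) //= big1 => [|y ny].
  by rewrite ffunE eqxx mul1r invg1 mul1g addr0.
by rewrite ffunE (negPf ny) mul0r.
Qed.

Fact gr_1mul : right_id (gr_elt 1%g) gr_mul.
Proof.
move=> a; apply/ffunP=> x; rewrite !ffunE (bigD1 x) //= big1 => [|y ny].
  by rewrite ffunE mulVg eqxx mulr1 addr0.
by rewrite ffunE -eq_mulVg1 (negPf ny) mulr0.
Qed.

Fact gr_mulDl : left_distributive gr_mul +%R.
Proof.
move=> a b c; apply/ffunP=> x; rewrite !ffunE -big_split /=.
by apply: eq_bigr => y _; rewrite ffunE mulrDl.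
Qed.

Fact gr_mulDr : right_distributive gr_mul +%R.
Proof.
move=> a b c; apply/ffunP=> x; rewrite !ffunE -big_split /=.
by apply: eq_bigr => y _; rewrite ffunE mulrDr.
Qed.

Fact gr_oner_neq0 : gr_elt 1%g != 0.
Proof. by apply/eqP => /ffunP /(_ 1%g); rewrite !ffunE eqxx. Qed.

HB.instance Definition _ := GRing.Zmodule_isNzRing.Build (group_ring gT)
  gr_mulA gr_mul1 gr_1mul gr_mulDl gr_mulDr gr_oner_neq0.

End IntegralGroupRing.

Section Wreath.
Local Open Scope group_scope.

Record wreath (gT : finGroupType) (n : nat) : Type :=
  Wreath { wr_base : {ffun 'I_n -> gT}; wr_perm : 'S_n }.

Variables (gT : finGroupType) (n : nat).

Definition wreath_pair (x : wreath gT n) := (wr_base x, wr_perm x).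
Definition pair_wreath (p : {ffun 'I_n -> gT} * 'S_n) := Wreath p.1 p.2.

Fact wreath_pairK : cancel wreath_pair pair_wreath. Proof. by case. Qed.

HB.instance Definition _ :=
  Finite.copy (wreath gT n) (can_type wreath_pairK).

                                                                   
                                                               
                                                                   
Definition wr_mul (x y : wreath gT n) : wreath gT n :=
  Wreath [ffun i => wr_base x i * wr_base y ((wr_perm x)^-1 i)]
         (wr_perm y * wr_perm x).

Definition wr_one : wreath gT n := Wreath [ffun=> 1] 1.

Definition wr_inv (x : wreath gT n) : wreath gT n :=
  Wreath [ffun i => (wr_base x (wr_perm x i))^-1] (wr_perm x)^-1.

Fact wr_mulA : associative wr_mul.
Proof.
case=> [g s] [h t] [k u]; rewrite /wr_mul /= mulgA; congr Wreath.
by apply/ffunP=> i; rewrite !ffunE /= invMg permM mulgA.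
Qed.

Fact wr_mul1 : left_id wr_one wr_mul.
Proof.
case=> g s; rewrite /wr_mul /= mulg1; congr Wreath.
by apply/ffunP=> i; rewrite !ffunE mul1g invg1 perm1.
Qed.

Fact wr_mulV : left_inverse wr_one wr_inv wr_mul.
Proof.
case=> g s; rewrite /wr_mul /= mulgV; congr Wreath.
by apply/ffunP=> i; rewrite !ffunE invgK mulVg.
Qed.

HB.instance Definition _ :=
  Finite_isGroup.Build (wreath gT n) wr_mulA wr_mul1 wr_mulV.

End Wreath.

Definition is_partition (s : seq nat) : bool := sorted geq s && (0 \notin s).

Record partition_nat : Type :=
  PartitionNat { parts :> seq nat; _ : is_partition parts }.
HB.instance Definition _ := [isSub for parts].
HB.instance Definition _ := [Choice of partition_nat by <:].

Definition conj_class (gT : finGroupType) : Type :=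
  {c : {set gT} | c \in classes [set: gT]}.
HB.instance Definition _ gT :=
  Finite.copy (conj_class gT) {c : {set gT} | c \in classes [set: gT]}.

Definition class_id (gT : finGroupType) : conj_class gT :=
  exist _ 1%g (classes1 [set: gT]%G).

Definition ptype (gT : finGroupType) : Type :=
  {ffun conj_class gT -> partition_nat}.
HB.instance Definition _ gT :=
  Choice.copy (ptype gT) {ffun conj_class gT -> partition_nat}.

Definition ptype_size (gT : finGroupType) (lam : ptype gT) : nat :=
  \sum_(c : conj_class gT) sumn (lam c).

Section Types.
Variables (gT : finGroupType) (n : nat).

                                                                        
                                                                       
Definition cycle_product (x : wreath gT n) (i : 'I_n) : gT :=
  (\prod_(j <- rev (traject (wr_perm x) i #|porbit (wr_perm x) i|))
     wr_base x j)%g.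

                                                                   
                                                            
Definition cycle_lengths (x : wreath gT n) (c : conj_class gT) : seq nat :=
  [seq #|A| | A : {set 'I_n} in
     [set A in porbits (wr_perm x) | [exists i in A, cycle_product x i \in val c]]].

Lemma normalize_partition (s : seq nat) :
  is_partition (sort geq [seq r <- s | 0 < r]).
Proof.
rewrite /is_partition mem_sort mem_filter ltnn andbT.
by apply: sort_sorted => a b; apply: leq_total.
Qed.

Definition to_partition (s : seq nat) : partition_nat :=
  PartitionNat (normalize_partition s).

Definition wr_type (x : wreath gT n) : ptype gT :=
  [ffun c => to_partition (cycle_lengths x c)].

Definition modified_type (x : wreath gT n) : ptype gT :=
  [ffun c => if c == class_id gT
             then to_partition [seq r.-1 | r <- wr_type x c]
             else wr_type x c].

End Types.

Section ClassSums.
Local Open Scope ring_scope.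
Variable gT : finGroupType.

Definition class_sum (n : nat) (lam : ptype gT) : group_ring (wreath gT n) :=
  \sum_(x : wreath gT n | modified_type x == lam) gr_elt x.

                                                                           
                                                               
Definition is_expansion (n : nat) (lam mu : ptype gT) (a : ptype gT -> int) :=
  class_sum n lam * class_sum n mu
    = \sum_(kap \in [set: ptype gT]%classic) class_sum n kap *~ a kap.

Definition is_structure_constant (n : nat) (lam mu nu : ptype gT) (z : int) :=
  exists2 a : ptype gT -> int, is_expansion n lam mu a & a nu = z.

Definition class_sum_bound (nu : ptype gT) : nat :=
  (ptype_size nu + size (nu (class_id gT)))%N.

Definition interpolates_structure_constants
    (lam mu nu : ptype gT) (f : {poly rat}) : Prop :=
  forall n : nat, (0 < n)%N -> (class_sum_bound nu <= n)%N ->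
    exists2 z : int, is_structure_constant n lam mu nu z & f.[n%:R] = z%:~R.

End ClassSums.

(* Main.v *)
Require Import Defs.
From mathcomp Require Import all_boot all_order all_algebra all_fingroup.
From mathcomp Require classical_sets fsbigop.
Set Implicit Arguments.
Unset Strict Implicit.
Unset Printing Implicit Defensive.
Import GRing.Theory.

(** Write Gamma_n for the wreath product. The support of x is the set of points
    that x moves or labels by a nontrivial element; its size is the bound
    ||lam|| + l(lam(c^0)) attached to the modified type lam of x.

    Polynomiality. For x of modified type nu, the coefficient of x in
    K_lam(n) K_mu(n) is the number of y of type lam such that y^-1 x has
    type mu. These y are sorted by the set U of points lying in the support of
    y or of y^-1 x. This U contains the support of x, and everything takes
    place inside the copy of Gamma_k attached to U, where k = #|U|; so the
    number of y with a given U is the number M(k) of factorizations of full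
    support of one element of type nu in Gamma_k. It depends on k only, because
    elements of equal modified type are conjugate
    ([modified_type_conjugate]) and modified types survive the embeddings
    Gamma_k -> Gamma_n ([modified_type_embed]). With b = ||nu|| + l(nu(c^0))
    there are C(n - b, i) sets U of size b + i, hence
    a(n) = sum_i M(b + i) C(n - b, i), and M(k) = 0 once k exceeds the sum of
    the bounds of lam and mu ([card_factors_binomial]). The polynomial is unique
    since elements of type nu exist for all n >= b ([modified_type_exists]).

    Constancy. The number ||lam|| is n minus the number of cycles of x with
    trivial cycle product, so it is a length attached to invariants: let x act on
    functions from {1..n} to Gamma + {0} and let q = |Gamma| + 1; the invariant
    functions number q^(n - ||lam||). Although Gamma + {0} is not a vector space,
    the sets of invariants behave like linear subspaces: they are cut out by
    equations u(j) = a u(i), and each such equation either holds already or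
    divides the number of solutions by exactly q. Therefore
    |Inv y| |Inv z| <= q^n |Inv y :&: Inv z| ([sol_submodular]). Since
    Inv y :&: Inv z is contained in Inv (y z), equality of lengths
    ||yz|| = ||y|| + ||z|| forces Inv y :&: Inv z = Inv (y z). A point is outside
    the support of x exactly when its indicator function is invariant, so then
    the support of y z is the union of the supports of y and z
    ([wr_support_additive]). Thus M(b + i) = 0 for i > 0 when
    ||nu|| = ||lam|| + ||mu||, and the polynomial is the constant M(b). *)

(* [order] alone denotes the order of a group element here; this is the length
   of an orbit of a function. *)
Local Notation forder := fingraph.order.

(** * Conjugacy classes of elements *)

Section ConjugacyClassOf.
Local Open Scope group_scope.
Variable gT : finGroupType.
Implicit Types (x y : gT) (c : conj_class gT).

(** The conjugacy class of [x], as an element of the index set of types. *)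
Definition class_of x : conj_class gT :=
  exist _ (x ^: [set: gT]) (mem_classes (in_setT x)).

Lemma mem_class_of x c : (x \in val c) = (class_of x == c).
Proof.
apply/idP/eqP => [xc | <-]; last exact: class_refl.
apply/val_inj => /=; case: c xc => _ /= /imsetP[z _ ->] /class_eqP; exact.
Qed.


Lemma class_of_eq_id x : (class_of x == class_id gT) = (x == 1).
Proof. by rewrite -mem_class_of /= inE. Qed.

Lemma class_of_eqP x y :
  reflect (exists a, y = a * x * a^-1) (class_of x == class_of y).
Proof.
rewrite eq_sym -mem_class_of /=; apply: (iffP imsetP) => [[a _ ->]|[a ->]].
  by exists a^-1; rewrite invgK conjgE mulgA.
by exists a^-1; rewrite ?in_setT // conjgE invgK mulgA.
Qed.

Lemma class_of_mulJ a x : class_of (a * x * a^-1) = class_of x.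
Proof. by apply/esym/eqP/class_of_eqP; exists a. Qed.

Lemma class_of_surj c : exists x, class_of x = c.
Proof.
case: c => A Ac; have /imsetP[x _ Ax] := Ac; exists x.
by apply/val_inj => /=; rewrite Ax.
Qed.

End ConjugacyClassOf.

(** * Labelled cycles: lengths and cycle products *)

Section PathProducts.
Local Open Scope group_scope.
Variables (gT : finGroupType) (T : finType) (f : T -> T) (g : T -> gT).

(** The product g(f^(k-1) i) ... g(f i) g(i) of the labels met along [k] steps of
    [f] from [i], the latest factor on the left. *)
Definition path_prod (i : T) (k : nat) : gT :=
  \prod_(j <- rev (traject f i k)) g j.

(** The cycle product read from [i]: one full turn of the orbit of [i]. *)
Definition cycle_prod (i : T) : gT := path_prod i (forder f i).

(** The length of the cycle through [i] and the class of its cycle product. Both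
    are constant along the cycle, so that types can be computed by counting
    points instead of cycles. *)
Definition cycle_key (i : T) : nat * conj_class gT :=
  (forder f i, class_of (cycle_prod i)).

Lemma path_prod0 i : path_prod i 0 = 1.
Proof. by rewrite /path_prod big_nil. Qed.

Lemma path_prodS i k : path_prod i k.+1 = g (iter k f i) * path_prod i k.
Proof. by rewrite /path_prod trajectSr rev_rcons big_cons. Qed.

Lemma path_prodSl i k : path_prod i k.+1 = path_prod (f i) k * g i.
Proof. by rewrite /path_prod trajectS rev_cons -cats1 big_cat big_seq1. Qed.

Hypothesis injf : injective f.

Lemma forder_step i : forder f (f i) = forder f i.
Proof. by apply: eq_card => j; rewrite !inE -same_fconnect1. Qed.

Lemma cycle_prod_step i : cycle_prod (f i) = g i * cycle_prod i * (g i)^-1.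
Proof.
apply: (mulIg (g i)); rewrite mulgKV /cycle_prod forder_step.
by rewrite -path_prodSl path_prodS iter_order.
Qed.

Lemma cycle_key_step i : cycle_key (f i) = cycle_key i.
Proof.
rewrite /cycle_key forder_step cycle_prod_step; congr pair.
by rewrite class_of_mulJ.
Qed.

Lemma cycle_key_iter k i : cycle_key (iter k f i) = cycle_key i.
Proof. by elim: k => //= k IH; rewrite cycle_key_step. Qed.

Lemma cycle_key_connect i j : fconnect f i j -> cycle_key j = cycle_key i.
Proof. by move/iter_findex <-; exact: cycle_key_iter. Qed.

Lemma cycle_key_root i : cycle_key (froot f i) = cycle_key i.
Proof. by apply: cycle_key_connect; apply: connect_root. Qed.

Lemma connect_iter_root i : iter (findex f (froot f i) i) f (froot f i) = i.
Proof.
by apply: iter_findex; rewrite (fconnect_sym injf) connect_root.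
Qed.

Lemma froot_step i : froot f (f i) = froot f i.
Proof.
by apply/esym/eqP; rewrite (root_connect (fconnect_sym injf)) fconnect1.
Qed.

Lemma froot_iter k i : froot f (iter k f i) = froot f i.
Proof. by elim: k => //= k IH; rewrite froot_step. Qed.

(** The position of a point on its cycle, counted from the root, increases by one
    at each step and returns to 0 after a full turn. *)
Lemma findex_root_step i :
  findex f (froot f i) (f i) =
    if (findex f (froot f i) i).+1 < forder f (froot f i)
    then (findex f (froot f i) i).+1 else 0%N.
Proof.
set r := froot f i; set k := findex f r i.
have Ei : iter k f r = i by exact: connect_iter_root.
have -> : f i = iter k.+1 f r by rewrite iterS Ei.
case: ltnP => lek; first by rewrite findex_iter.
suff -> : k.+1 = forder f r by rewrite (iter_order injf) findex0.
apply/eqP; rewrite eqn_leq lek andbT; apply: findex_max.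
by rewrite (fconnect_sym injf) connect_root.
Qed.

(** One point on each cycle of length [v.1] and class [v.2]. *)
Definition cycle_roots (v : nat * conj_class gT) : {set T} :=
  [set r | (froot f r == r) && (cycle_key r == v)].

Lemma card_froot_fiber r : froot f r = r ->
  #|[set i | froot f i == r]| = forder f r.
Proof.
move=> Er; apply: eq_card => i; rewrite inE -{1}Er.
by rewrite (root_connect (fconnect_sym injf)) (fconnect_sym injf).
Qed.

Lemma card_cycle_roots v :
  (#|cycle_roots v| * v.1)%N = #|[set i | cycle_key i == v]|.
Proof.
rewrite -[RHS]sum1_card (partition_big (froot f) (mem (cycle_roots v))) /=; last first.
  move=> i; rewrite !inE cycle_key_root => ->.
  by rewrite (root_root (fconnect_sym injf)) eqxx.
rewrite -sum_nat_const; apply: eq_bigr => r; rewrite inE => /andP[/eqP Er /eqP Ev].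
rewrite sum1_card -[v.1]/(v.1) -{1}Ev /= -card_froot_fiber //; apply: eq_card => i.
rewrite !inE unfold_in /=; apply/esym; case: eqP => Ei; last by rewrite andbF.
by rewrite andbT inE -cycle_key_root Ei Ev eqxx.
Qed.

Lemma cycle_keyE i : cycle_key i = (forder f i, class_of (cycle_prod i)).
Proof. by []. Qed.

End PathProducts.
(* Kept folded: comparing two keys must not unfold the cardinal in [forder]. *)
Opaque cycle_key.

(** An injection [e] that commutes with the dynamics and twists the labels by a
    coboundary [K] preserves keys. This covers conjugation in the wreath product
    ([e] a permutation) and the embeddings of smaller ones ([K] trivial). *)
Section Transfer.
Local Open Scope group_scope.
Variables (gT : finGroupType) (T T' : finType).
Variables (f : T -> T) (g : T -> gT) (f' : T' -> T') (g' : T' -> gT).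
Variables (e : T -> T') (K : T -> gT).
Hypothesis injf : injective f.
Hypothesis inje : injective e.
Hypothesis fe : forall i, f' (e i) = e (f i).
Hypothesis ge : forall i, g' (e i) = K (f i) * g i * (K i)^-1.

Lemma iter_transfer k i : iter k f' (e i) = e (iter k f i).
Proof. by elim: k => //= k ->; rewrite fe. Qed.

Lemma forder_transfer i : forder f' (e i) = forder f i.
Proof.
rewrite /fingraph.order -[RHS](card_image inje); apply: eq_card => j.
apply/idP/imageP => [/iter_findex <-|[i' ii' ->]].
  exists (iter (findex f' (e i) j) f i); last exact: iter_transfer.
  by rewrite inE fconnect_iter.
by rewrite inE -(iter_findex ii') -iter_transfer fconnect_iter.
Qed.

Lemma path_prod_transfer k i :
  path_prod f' g' (e i) k = K (iter k f i) * path_prod f g i k * (K i)^-1.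
Proof.
elim: k => [|k IH]; first by rewrite !path_prod0 mulg1 mulgV.
by rewrite !path_prodS IH iter_transfer ge iterS !mulgA mulgKV.
Qed.

Lemma cycle_key_transfer i : cycle_key f' g' (e i) = cycle_key f g i.
Proof.
rewrite !cycle_keyE /cycle_prod forder_transfer path_prod_transfer.
by rewrite (iter_order injf) class_of_mulJ.
Qed.

End Transfer.

(** Conversely, two labelled maps with as many points of each key are isomorphic
    up to a coboundary. *)
Section Matching.
Local Open Scope group_scope.
Variables (gT : finGroupType) (T T' : finType).
Variables (f : T -> T) (g : T -> gT) (f' : T' -> T') (g' : T' -> gT).
Hypothesis injf : injective f.
Hypothesis injf' : injective f'.
Hypothesis same_keys : forall v,
  #|[set i | cycle_key f g i == v]| = #|[set i | cycle_key f' g' i == v]|.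

Let card_roots v : #|cycle_roots f g v| = #|cycle_roots f' g' v|.
Proof.
case: (posnP v.1) => [v0|vgt0]; last first.
  by apply/eqP; rewrite -(eqn_pmul2r vgt0) !card_cycle_roots ?same_keys.
rewrite !eq_card0 // => i; rewrite inE; apply/negP => /andP[_ /eqP Ev].
  by have := fingraph.order_gt0 f' i; move: v0; rewrite -Ev cycle_keyE /= => ->.
by have := fingraph.order_gt0 f i; move: v0; rewrite -Ev cycle_keyE /= => ->.
Qed.

(** With equally many roots of each key, roots are matched by their ranks in the
    two enumerations. *)
Lemma match_roots : exists2 phi : T -> T',
  forall r, froot f r = r ->
    froot f' (phi r) = phi r /\ cycle_key f' g' (phi r) = cycle_key f g r &
  forall r s, froot f r = r -> froot f s = s -> phi r = phi s -> r = s.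
Proof.
pose R v := enum (cycle_roots f g v); pose R' v := enum (cycle_roots f' g' v).
have memR r : froot f r = r -> r \in R (cycle_key f g r).
  by move=> Er; rewrite mem_enum inE Er !eqxx.
have szR v : size (R v) = size (R' v) by rewrite -!cardE card_roots.
have [r0 _|noT] := pickP (mem T); last first.
  have F : T -> False by move=> r; have := noT r.
  by exists (fun r => match F r with end) => r; case: (F r).
have y0 : T'.
  have : index (froot f r0) (R (cycle_key f g r0)) < size (R' (cycle_key f g r0)).
    by rewrite -szR index_mem -(cycle_key_root g injf) memR ?(root_root (fconnect_sym injf)).
  by case: (R' _) => // y.
have [phi phiR phiI] : exists2 phi : T -> T',
    forall r, froot f r = r -> phi r \in R' (cycle_key f g r) &
    forall r s, froot f r = r -> froot f s = s ->
      cycle_key f g r = cycle_key f g s -> phi r = phi s -> r = s.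
  exists (fun r => nth y0 (R' (cycle_key f g r)) (index r (R (cycle_key f g r)))).
    by move=> r Er; apply: mem_nth; rewrite -szR index_mem memR.
  move=> r s Er Es Ek /eqP.
  have ms := memR s Es.
  have mr := memR r Er.
  move: (cycle_key f g r) (cycle_key f g s) Ek ms mr => v _ <- ms mr.
  rewrite nth_uniq ?enum_uniq -?szR ?index_mem // => /eqP.
  exact: index_inj.
have phiP r : froot f r = r ->
    froot f' (phi r) = phi r /\ cycle_key f' g' (phi r) = cycle_key f g r.
  by move/phiR; rewrite mem_enum inE => /andP[/eqP-> /eqP->].
exists phi => // r s Er Es Ephi; apply: phiI => //.
by have [_ <-] := phiP s Es; have [_ <-] := phiP r Er; rewrite Ephi.
Qed.

(** The isomorphism follows the matching of roots along the cycles; on the cycle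
    of the root [r] the coboundary starts with an element [a r] conjugating one
    cycle product to the other, which is what makes it close up. *)
Lemma match_cycles : exists e : T -> T', exists2 K : T -> gT,
  injective e & forall i,
    f' (e i) = e (f i) /\ g' (e i) = K (f i) * g i * (K i)^-1.
Proof.
have [phi phiP phi_inj] := match_roots.
have rr i : froot f (froot f i) = froot f i by rewrite (root_root (fconnect_sym injf)).
pose r i := froot f i.
have /fin_all_exists[a aP] i : exists a : gT,
    cycle_prod f' g' (phi (r i)) = a * cycle_prod f g (r i) * a^-1.
  apply/class_of_eqP/eqP; have /= [_] := phiP _ (rr i).
  by rewrite !cycle_keyE => /(congr1 snd) /= ->.
pose k i := findex f (r i) i.
pose e i := iter (k i) f' (phi (r i)).
pose K i := path_prod f' g' (phi (r i)) (k i) * a (r i) * (path_prod f g (r i) (k i))^-1.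
have a_r i : cycle_prod f' g' (phi (r i)) = a (r i) * cycle_prod f g (r i) * (a (r i))^-1.
  by have := aP (r i); rewrite /r rr.
have rS i : r (f i) = r i by exact: froot_step.
have ord i : forder f' (phi (r i)) = forder f (r i).
  by have [_] := phiP _ (rr i); rewrite !cycle_keyE => /(congr1 fst).
have kS i : k (f i) = if (k i).+1 < forder f (r i) then (k i).+1 else 0%N.
  by rewrite /k rS findex_root_step.
have k_lt i : k i < forder f (r i).
  by apply: findex_max; rewrite (fconnect_sym injf) connect_root.
have kE i : (forder f (r i) <= (k i).+1)%N -> forder f (r i) = (k i).+1.
  by move=> le; apply/eqP; rewrite eqn_leq le k_lt.
exists e, K => [i j Eij|i].
- have Er : r i = r j.
    apply: phi_inj; rewrite ?rr // -(phiP _ (rr i)).1 -(phiP _ (rr j)).1.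
    by have := congr1 (froot f') Eij; rewrite !froot_iter.
  have := congr1 (findex f' (phi (r i))) Eij.
  rewrite /e -Er !findex_iter ?ord ?k_lt //; last by rewrite Er k_lt.
  move=> Ek; rewrite -(connect_iter_root injf i) -(connect_iter_root injf j).
  by rewrite -/(r i) -/(r j) -/(k i) -/(k j) Ek Er.
  (* [k (f i)] is [(k i).+1], except that it is 0 when [i] ends its cycle; in
     that case the two cycle products appear and [a_r] applies. *)
- have Ef : f' (e i) = e (f i).
    rewrite /e kS rS -iterS; case: ltnP => // /kE <-.
    by rewrite -ord (iter_order injf').
  split=> //; rewrite /K rS kS.
  have gi : path_prod f g (r i) (k i).+1 = g i * path_prod f g (r i) (k i).
    by rewrite path_prodS connect_iter_root.
  have gi' : path_prod f' g' (phi (r i)) (k i).+1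
      = g' (e i) * path_prod f' g' (phi (r i)) (k i) by rewrite path_prodS.
  case: ltnP => [_|/kE ki].
    by rewrite gi gi' !invMg invgK !mulgA !(mulgKV, mulgK).
  have := a_r i; rewrite /cycle_prod ord ki gi gi' !path_prod0 invg1 mulg1 mul1g => E.
  apply: (mulIg (path_prod f' g' (phi (r i)) (k i))); rewrite E.
  by rewrite !invMg invgK !mulgA mulgKV.
Qed.

End Matching.

(** * The modified type computed from keys *)

Section PartitionExtensionality.

Lemma partition_natP (s t : partition_nat) :
  (forall l, 0 < l -> count_mem l s = count_mem l t) -> s = t.
Proof.
move=> Est; apply: val_inj.
case: s t Est => [s /andP[s_sorted s0]] [t /andP[t_sorted t0]] /= Est.
apply: (sorted_eq _ _ s_sorted t_sorted) => [a b c ab bc|a b|].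
- exact: leq_trans bc ab.
- by rewrite andbC -eqn_leq => /eqP.
apply/allP => -[_|l _] /=; last by rewrite Est.
by rewrite !(count_memPn _).
Qed.

Variable gT : finGroupType.

Lemma ptypeP (lam mu : ptype gT) :
  (forall c l, 0 < l -> count_mem l (lam c) = count_mem l (mu c)) -> lam = mu.
Proof. by move=> E; apply/ffunP => c; apply: partition_natP => l; apply: E. Qed.

End PartitionExtensionality.

Section ModifiedType.
Local Open Scope group_scope.
Variable gT : finGroupType.

(** The key of the cycle through a point, for an element of the wreath product. *)
Definition wr_key n (x : wreath gT n) : 'I_n -> nat * conj_class gT :=
  cycle_key (wr_perm x) (wr_base x).

(** The points moved by [x] or carrying a nontrivial label. *)
Definition wr_support n (x : wreath gT n) : {set 'I_n} :=
  [set i | (wr_perm x i != i) || (wr_base x i != 1)].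

Variables (n : nat) (x : wreath gT n).
Let s := wr_perm x.
Let g := wr_base x.
Let injs : injective s := @perm_inj _ s.

Lemma mem_porbit_fconnect (u : 'S_n) i j : (j \in porbit u i) = fconnect u i j.
Proof.
apply/porbitP/idP => [[k ->]|/iter_findex <-].
  by rewrite permX fconnect_iter.
by exists (findex u i j); rewrite permX.
Qed.

Lemma card_porbit_forder (u : 'S_n) i : #|porbit u i| = forder u i.
Proof. by apply: eq_card => j; rewrite mem_porbit_fconnect inE. Qed.

Lemma cycle_productE i : cycle_product x i = cycle_prod s g i.
Proof. by rewrite /cycle_product card_porbit_forder. Qed.

(** One point on each cycle whose cycle product is in [c]. *)
Definition class_roots (c : conj_class gT) : {set 'I_n} :=
  [set r | (froot s r == r) && (class_of (cycle_prod s g r) == c)].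

Lemma class_prod_root i :
  class_of (cycle_prod s g (froot s i)) = class_of (cycle_prod s g i).
Proof. by have := cycle_key_root g injs i; rewrite !cycle_keyE => /(congr1 snd). Qed.

Lemma cycle_lengths_perm c :
  perm_eq (cycle_lengths x c) [seq forder s r | r <- enum (class_roots c)].
Proof.
rewrite /cycle_lengths -/s.
have -> : [set A in porbits s | [exists i in A, cycle_product x i \in val c]]
    = porbit s @: class_roots c.
  apply/setP => A; rewrite inE; apply/andP/imsetP => [[/imsetP[i _ ->]]|[r]].
    case/existsP => j /andP[]; rewrite mem_porbit_fconnect => ij.
    rewrite mem_class_of cycle_productE => jc.
    have ri : fconnect s (froot s i) i by rewrite (fconnect_sym injs) connect_root.
    exists (froot s i); last by apply/eqP; rewrite eq_porbit_mem mem_porbit_fconnect.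
    rewrite inE (root_root (fconnect_sym injs)) eqxx /= class_prod_root.
    by have := cycle_key_connect g injs ij; rewrite !cycle_keyE => /(congr1 snd) /= <-.
  rewrite inE => /andP[_ rc] ->; split; first exact: imset_f.
  by apply/existsP; exists r; rewrite porbit_id mem_class_of cycle_productE.
have inj_porbit : {in class_roots c &, injective (porbit s)}.
  move=> r r'; rewrite !inE => /andP[/eqP Er _] /andP[/eqP Er' _] /eqP.
  rewrite eq_porbit_mem mem_porbit_fconnect -(root_connect (fconnect_sym injs)).
  by rewrite Er Er' eq_sym => /eqP.
rewrite [X in perm_eq _ X](_ : _ = [seq #|pred_of_set A| | A <-
    [seq porbit s r | r <- enum (class_roots c)]]); last first.
  by rewrite -map_comp; apply: eq_map => r /=; rewrite card_porbit_forder.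
apply: perm_map; apply: uniq_perm; rewrite ?enum_uniq //.
  rewrite map_inj_in_uniq ?enum_uniq // => r r'; rewrite !mem_enum; exact: inj_porbit.
move=> A; rewrite mem_enum; apply/imsetP/mapP => -[r rc ->]; exists r => //.
  by rewrite mem_enum.
by rewrite -mem_enum.
Qed.

(** The part contributed to the modified type by the cycle of [r], possibly 0. *)
Definition modified_part (c : conj_class gT) (r : 'I_n) : nat :=
  if c == class_id gT then (forder s r).-1 else forder s r.

Lemma modified_type_perm c :
  perm_eq (modified_type x c)
    [seq l <- [seq modified_part c r | r <- enum (class_roots c)] | 0 < l].
Proof.
have sortE t : perm_eq (to_partition t) [seq l <- t | 0 < l].
  by rewrite /= perm_sort.
have Pc : perm_eq (wr_type x c) [seq forder s r | r <- enum (class_roots c)].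
  rewrite ffunE; apply: perm_trans (sortE _) _.
  apply: perm_trans (perm_filter _ (cycle_lengths_perm c)) _.
  rewrite (all_filterP _) //; apply/allP => l /mapP[r _ ->].
  exact: fingraph.order_gt0.
rewrite ffunE /modified_part; case: eqP => [|] _.
  apply: perm_trans (sortE _) _; apply: perm_filter.
  by apply: perm_trans (perm_map _ Pc) _; rewrite -map_comp.
rewrite (all_filterP _) //; apply/allP => l /mapP[r _ ->].
exact: fingraph.order_gt0.
Qed.

Lemma count_modified_type c l : 0 < l ->
  count_mem l (modified_type x c) =
    #|cycle_roots s g (if c == class_id gT then l.+1 else l, c)|.
Proof.
move=> lgt0; rewrite (seq.permP (modified_type_perm c)) count_filter count_map.
rewrite -sum1_count big_enum_cond sum1_card; apply: eq_card => r.
rewrite !inE unfold_in /= inE cycle_keyE xpair_eqE -andbA; congr (_ && _).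
rewrite andbC; congr (_ && _); rewrite /modified_part.
have := fingraph.order_gt0 s r; case: ifP => _ ordgt0.
  rewrite -[forder s r]prednK // eqSS /=.
  by case: eqP => // ->.
by case: eqP => // ->.
Qed.

Lemma sumn_modified_type c :
  sumn (modified_type x c) = \sum_(r in class_roots c) modified_part c r.
Proof.
rewrite (perm_sumn (modified_type_perm c)) sumnE big_filter big_map big_enum_cond /=.
rewrite [RHS](bigID (fun r => 0 < modified_part c r)) /= [X in (_ + X)%N]big1 ?addn0 //.
by move=> r /andP[_]; rewrite -eqn0Ngt => /eqP.
Qed.

Lemma size_modified_type_id :
  size (modified_type x (class_id gT)) =
    #|[set r in class_roots (class_id gT) | 1 < forder s r]|.
Proof.
rewrite (perm_size (modified_type_perm _)) size_filter count_map.
rewrite -sum1_count big_enum_cond sum1_card; apply: eq_card => r.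
rewrite !inE unfold_in /= inE; congr (_ && _); rewrite /modified_part eqxx.
by have := fingraph.order_gt0 s r; case: (forder s r) => [|[]].
Qed.

Lemma sum_order_roots :
  \sum_(c : conj_class gT) \sum_(r in class_roots c) forder s r = n.
Proof.
rewrite -[RHS]card_ord -sum1_card (partition_big (froot s) (fun r => froot s r == r)) /=; last first.
  by move=> i _; rewrite (root_root (fconnect_sym injs)).
rewrite [RHS](partition_big (fun r => class_of (cycle_prod s g r)) xpredT) //=.
apply: eq_bigr => c _; rewrite [LHS](eq_bigl (fun r =>
  (froot s r == r) && (class_of (cycle_prod s g r) == c))); last by move=> r; rewrite inE.
apply: eq_bigr => r /andP[/eqP Er _].
by rewrite sum1_card -card_froot_fiber //; apply: eq_card => i; rewrite inE.
Qed.

(** ||lam|| is [n] minus the number of cycles with trivial cycle product. *)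
Lemma ptype_size_modified_type :
  (ptype_size (modified_type x) + #|class_roots (class_id gT)|)%N = n.
Proof.
rewrite -[RHS]sum_order_roots /ptype_size [RHS](bigD1 (class_id gT)) //=.
rewrite (bigD1 (class_id gT)) //= addnAC; congr (_ + _)%N.
  rewrite sumn_modified_type -sum1_card -big_split /=; apply: eq_bigr => r _.
  by rewrite /modified_part eqxx addn1 prednK ?fingraph.order_gt0.
apply: eq_bigr => c nc; rewrite sumn_modified_type; apply: eq_bigr => r _.
by rewrite /modified_part (negPf nc).
Qed.

Lemma forder1 i : (forder s i == 1%N) = (s i == i).
Proof.
apply/eqP/eqP => [o1|si].
  by have := iter_order injs i; rewrite o1.
apply/eqP; rewrite eqn_leq fingraph.order_gt0 andbT.
rewrite -[X in _ <= X](cards1 i); apply/subset_leq_card/subsetP => j.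
rewrite !inE => /iter_findex <-; apply/eqP.
by elim: (findex _ _ _) => //= k ->.
Qed.

Lemma cycle_prod_fix i : s i = i -> cycle_prod s g i = g i.
Proof.
by move/eqP; rewrite -forder1 /cycle_prod => /eqP->; rewrite path_prodS path_prod0 mulg1.
Qed.

Lemma card_wr_support : #|wr_support x| = class_sum_bound (modified_type x).
Proof.
apply/eqP; rewrite -(eqn_add2r #|~: wr_support x|) cardsC card_ord.
rewrite -[X in X == _]ptype_size_modified_type /class_sum_bound -addnA eqn_add2l.
rewrite size_modified_type_id setIdE.
rewrite -(cardsID [set r | 1 < forder s r] (class_roots (class_id gT))) eqn_add2l.
apply/eqP/eq_card => i; rewrite !inE negb_or !negbK class_of_eq_id -/s -/g.
rewrite -leqNgt; have := fingraph.order_gt0 s i.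
case: (ltngtP (forder s i) 1%N) => [|o1 _|o1 _]; first by case: (forder s i).
  by apply/esym/negbTE; rewrite -forder1 gtn_eqF.
have si : s i = i by apply/eqP; rewrite -forder1 o1.
rewrite si eqxx cycle_prod_fix //= (_ : froot s i = i) ?eqxx //.
have /iter_findex <- : fconnect s i (froot s i) by exact: connect_root.
by elim: (findex _ _ _) => //= k ->.
Qed.

End ModifiedType.

(** * Conjugacy and modified types *)

Section TypesAndKeys.
Local Open Scope group_scope.
Variable gT : finGroupType.

(** The key of the points outside the support: fixed, with label 1. *)
Definition trivial_key : nat * conj_class gT := (1%N, class_id gT).

(** The points of key [v]. *)
Definition key_class n (x : wreath gT n) v := [set i | wr_key x i == v].

Lemma wr_key_trivial n (x : wreath gT n) i :
  (wr_key x i == trivial_key) = (i \notin wr_support x).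
Proof.
rewrite inE negb_or !negbK /wr_key cycle_keyE xpair_eqE forder1 class_of_eq_id.
by case: eqP => //= si; rewrite cycle_prod_fix.
Qed.

Lemma key_class_order0 n (x : wreath gT n) c : key_class x (0%N, c) = set0.
Proof.
apply/setP => i; rewrite !inE /wr_key cycle_keyE xpair_eqE.
by rewrite eqn0Ngt fingraph.order_gt0.
Qed.

Lemma card_key_class_trivial n (x : wreath gT n) :
  (#|key_class x trivial_key| + class_sum_bound (modified_type x))%N = n.
Proof.
rewrite -card_wr_support addnC -[RHS]card_ord -(cardsC (wr_support x)).
by congr (_ + _)%N; apply: eq_card => i; rewrite in_setC inE wr_key_trivial.
Qed.

(** A part [l] at [c] comes from a cycle of length [l], or [l.+1] at the identity
    class, and this cycle accounts for as many points as its length. *)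
Lemma modified_type_keys n (x : wreath gT n) (nu : ptype gT) :
  (forall c l, 0 < l -> let l' := if c == class_id gT then l.+1 else l in
     #|key_class x (l', c)| = (count_mem l (nu c) * l')%N) ->
  modified_type x = nu.
Proof.
move=> E; apply: ptypeP => c l lgt0; apply/eqP.
rewrite count_modified_type //; set l' := if _ then _ else _.
have l'gt0 : 0 < l' by rewrite /l'; case: ifP.
rewrite -(eqn_pmul2r l'gt0); have /= := E c l lgt0; rewrite -/l' => <-.
by apply/eqP; have := @card_cycle_roots _ _ _ (wr_base x) (@perm_inj _ (wr_perm x)) (l', c); apply.
Qed.

Lemma card_key_class n (x : wreath gT n) c l : 0 < l ->
  let l' := if c == class_id gT then l.+1 else l in
  #|key_class x (l', c)| = (count_mem l (modified_type x c) * l')%N.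
Proof.
move=> lgt0 /=; rewrite count_modified_type //.
exact/esym/(@card_cycle_roots _ _ _ _ (@perm_inj _ _) (_, _)).
Qed.

Lemma eq_modified_type m n (x : wreath gT m) (y : wreath gT n) :
  (forall v, v != trivial_key -> #|key_class x v| = #|key_class y v|) ->
  modified_type x = modified_type y.
Proof.
move=> E; apply: modified_type_keys => c l lgt0 /=; rewrite -(card_key_class y c lgt0).
apply: E; rewrite xpair_eqE; case: (eqVneq c (class_id gT)) => _; last by rewrite andbF.
by case: l lgt0.
Qed.

Lemma eq_key_class n (x y : wreath gT n) : modified_type x = modified_type y ->
  forall v, #|key_class x v| = #|key_class y v|.
Proof.
move=> E [l c]; case: (eqVneq (l, c) trivial_key) => [->|].
  apply/eqP; rewrite -(eqn_add2r (class_sum_bound (modified_type x))).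
  by rewrite {2}E !card_key_class_trivial.
case: l => [|l]; first by rewrite !key_class_order0.
case: (eqVneq c (class_id gT)) => [->|nc _].
  case: l => [|l _]; first by rewrite eqxx.
  by have := fun z => @card_key_class n z (class_id gT) l.+1 isT; rewrite eqxx /= => C; rewrite !C E.
have := fun z => @card_key_class n z c l.+1 isT; rewrite (negPf nc) /= => C.
by rewrite !C E.
Qed.

Lemma wreath_ext n (x y : wreath gT n) :
  wr_perm x =1 wr_perm y -> wr_base x =1 wr_base y -> x = y.
Proof. by case: x y => [g s] [h t] /= /permP -> /ffunP ->. Qed.

Lemma wr_permM n (x y : wreath gT n) i : wr_perm (x * y) i = wr_perm x (wr_perm y i).
Proof. by rewrite permM. Qed.

Lemma wr_baseM n (x y : wreath gT n) i :
  wr_base (x * y) (wr_perm x i) = wr_base x (wr_perm x i) * wr_base y i.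
Proof. by rewrite ffunE permK. Qed.

(** Conjugation by [w] moves the point [i] to [wr_perm w i]. *)
Lemma wr_key_intertwine n (w x y : wreath gT n) i :
  w * x = y * w -> wr_key y (wr_perm w i) = wr_key x i.
Proof.
move=> E; set t := wr_perm w.
have fe j : wr_perm y (t j) = t (wr_perm x j) by rewrite -!wr_permM E.
pose K j := wr_base w (t ((wr_perm x)^-1 j)).
have ge j : wr_base y (t j) = K (wr_perm x j) * wr_base x j * (K j)^-1.
  rewrite /K permK; apply: canRL (mulgK _) _.
  rewrite -wr_baseM E -/t -[in t j](permKV (wr_perm x) j) -fe.
  by rewrite wr_baseM.
exact: (cycle_key_transfer (@perm_inj _ _) (@perm_inj _ t) fe ge).
Qed.

Lemma key_class_intertwine n (w x y : wreath gT n) v :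
  w * x = y * w -> key_class y v = wr_perm w @: key_class x v.
Proof.
move=> E; apply/setP => i; rewrite -[i](permKV (wr_perm w)).
by rewrite (mem_imset _ _ (@perm_inj _ _)) !inE (wr_key_intertwine _ E).
Qed.

Lemma wr_support_intertwine n (w x y : wreath gT n) :
  w * x = y * w -> wr_support y = wr_perm w @: wr_support x.
Proof.
move=> E; apply/setP => i; rewrite -[i](permKV (wr_perm w)).
rewrite (mem_imset _ _ (@perm_inj _ _)); apply: negb_inj.
by rewrite -!wr_key_trivial (wr_key_intertwine _ E).
Qed.

Lemma modified_type_intertwine n (w x y : wreath gT n) :
  w * x = y * w -> modified_type x = modified_type y.
Proof.
move=> E; apply: eq_modified_type => v _.
by rewrite (key_class_intertwine v E) (card_imset _ (@perm_inj _ _)).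
Qed.

Lemma modified_typeJ n (x w : wreath gT n) : modified_type (x ^ w) = modified_type x.
Proof. by apply: (@modified_type_intertwine _ w); rewrite conjgE mulKVg. Qed.

Lemma wr_supportJ n (x w : wreath gT n) :
  wr_support x = wr_perm w @: wr_support (x ^ w).
Proof. by apply: wr_support_intertwine; rewrite conjgE mulKVg. Qed.

Lemma modified_type_conjugate n (x y : wreath gT n) :
  modified_type x = modified_type y -> exists w, y = x ^ w.
Proof.
move=> E; have [e [K inje eP]] := match_cycles (@perm_inj _ (wr_perm x))
  (@perm_inj _ (wr_perm y)) (eq_key_class E).
pose t := perm inje.
pose w := Wreath [ffun i => K (wr_perm x (t^-1 i))] t : wreath gT n.
suff wx : w * x = y * w.
  by exists w^-1; rewrite conjgE invgK mulgA wx mulgK.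
apply: wreath_ext => i.
  by rewrite !wr_permM /= !permE (eP i).1.
rewrite -[i](permKV t) -[t in LHS]/(wr_perm w) wr_baseM.
set j := t^-1 i; rewrite -[wr_perm w j]/(t j).
have tE i' : t i' = e i' by rewrite permE.
have Ej : wr_perm y (t ((wr_perm x)^-1 j)) = t j by rewrite !tE (eP _).1 permKV.
rewrite -[in RHS]Ej wr_baseM Ej !ffunE !permK permKV.
by rewrite tE (eP j).2 mulgKV.
Qed.

End TypesAndKeys.

(** * Embeddings of smaller wreath products *)

Section Embedding.
Local Open Scope group_scope.
Variables (gT : finGroupType) (k n : nat) (e : 'I_k -> 'I_n).
Hypothesis inje : injective e.
Implicit Types (y z : wreath gT k).

Let pick_e j : [pick j' | e j' == e j] = Some j.
Proof. by case: pickP => [j' /eqP/inje ->|/(_ j)]; rewrite ?eqxx. Qed.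

Let pick_out i : i \notin codom e -> [pick j | e j == i] = None.
Proof.
by move=> ni; case: pickP => // j /eqP ji; rewrite -ji codom_f in ni.
Qed.

(** [s] transported along [e], and the identity outside the image of [e]. *)
Definition extend_fun (s : 'I_k -> 'I_k) (i : 'I_n) : 'I_n :=
  if [pick j | e j == i] is Some j then e (s j) else i.

Lemma extend_fun_inj (s : 'S_k) : injective (extend_fun s).
Proof.
have codom_ext i : (extend_fun s i \in codom e) = (i \in codom e).
  rewrite /extend_fun; case: pickP => [j /eqP <-|//]; by rewrite !codom_f.
move=> i i' E; have Ec : (i \in codom e) = (i' \in codom e).
  by rewrite -codom_ext E codom_ext.
move: E; case: (boolP (i' \in codom e)) Ec => [/codomP[j' ->] /codomP[j ->]|ni' ni].
  by rewrite /extend_fun !pick_e => /inje/perm_inj ->.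
by rewrite /extend_fun !pick_out ?ni.
Qed.

(** The embedding of wreath products along an injection [e] of the points. *)
Definition wr_embed y : wreath gT n :=
  Wreath [ffun i => if [pick j | e j == i] is Some j then wr_base y j else 1]
         (perm (@extend_fun_inj (wr_perm y))).

Lemma wr_embed_perm y j : wr_perm (wr_embed y) (e j) = e (wr_perm y j).
Proof. by rewrite permE /extend_fun pick_e. Qed.

Lemma wr_embed_base y j : wr_base (wr_embed y) (e j) = wr_base y j.
Proof. by rewrite ffunE pick_e. Qed.

Lemma wr_embed_perm_out y i : i \notin codom e -> wr_perm (wr_embed y) i = i.
Proof. by move=> ni; rewrite permE /extend_fun pick_out. Qed.

Lemma wr_embed_base_out y i : i \notin codom e -> wr_base (wr_embed y) i = 1.
Proof. by move=> ni; rewrite ffunE pick_out. Qed.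

Lemma wr_embed_inj : injective wr_embed.
Proof.
move=> y z E; apply: wreath_ext => j; last by rewrite -!wr_embed_base E.
by apply: inje; rewrite -!wr_embed_perm E.
Qed.

Lemma wr_embedM y z : wr_embed (y * z) = wr_embed y * wr_embed z.
Proof.
apply: wreath_ext => i; case: (boolP (i \in codom e)) => [/codomP[j ->]|ni].
- by rewrite wr_permM !wr_embed_perm wr_permM.
- by rewrite wr_permM !wr_embed_perm_out.
- rewrite wr_embed_base -[j](permKV (wr_perm y)) -!wr_embed_perm !wr_baseM.
  by rewrite wr_embed_perm !wr_embed_base.
- rewrite -[X in _ = wr_base _ X](wr_embed_perm_out y ni) wr_baseM.
  by rewrite wr_embed_perm_out // !wr_embed_base_out // mulg1.
Qed.

Lemma wr_embedV y : wr_embed y^-1 = (wr_embed y)^-1.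
Proof.
have embed1 : wr_embed 1 = 1.
  by apply: (mulgI (wr_embed 1)); rewrite -wr_embedM !mulg1.
by apply: (mulgI (wr_embed y)); rewrite -wr_embedM !mulgV.
Qed.

Lemma wr_support_embed y : wr_support (wr_embed y) = e @: wr_support y.
Proof.
apply/setP => i; case: (boolP (i \in codom e)) => [/codomP[j ->]|ni].
  rewrite (mem_imset _ _ inje) !inE wr_embed_perm wr_embed_base.
  by rewrite (inj_eq inje).
rewrite inE wr_embed_perm_out // wr_embed_base_out // !eqxx.
by apply/esym/negP => /imsetP[j _ ij]; rewrite ij codom_f in ni.
Qed.

Lemma modified_type_embed y : modified_type (wr_embed y) = modified_type y.
Proof.
apply: eq_modified_type => v nv; rewrite -[RHS](card_imset _ inje).
apply: eq_card => i; case: (boolP (i \in codom e)) => [/codomP[j ->]|ni].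
  rewrite (mem_imset _ _ inje) !inE /wr_key.
  have ge j' : wr_base (wr_embed y) (e j') = 1 * wr_base y j' * 1^-1.
    by rewrite mul1g invg1 mulg1 wr_embed_base.
  by rewrite (cycle_key_transfer (K := fun=> 1) (@perm_inj _ _) inje (wr_embed_perm y) ge).
have -> : (i \in e @: key_class y v) = false.
  by apply/negP => /imsetP[j _ ij]; rewrite ij codom_f in ni.
rewrite inE; apply/negP => /eqP Ev; move: nv; rewrite -Ev wr_key_trivial.
rewrite wr_support_embed negbK => /imsetP[j _ ij].
by rewrite ij codom_f in ni.
Qed.

Lemma wr_embed_surj (x : wreath gT n) :
  wr_support x \subset codom e -> exists y, x = wr_embed y.
Proof.
move=> sx; have out i : i \notin codom e -> wr_perm x i = i /\ wr_base x i = 1.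
  move=> ni; have : i \notin wr_support x by apply: contra ni; apply: subsetP.
  by rewrite inE negb_or !negbK => /andP[/eqP-> /eqP->].
have /fin_all_exists[s sP] j : exists j', wr_perm x (e j) = e j'.
  case: (boolP (wr_perm x (e j) \in codom e)) => [/codomP[j' ->]|no].
    by exists j'.
  have [/perm_inj Ej _] := out _ no; by rewrite Ej codom_f in no.
have injs : injective s.
  by move=> j j' E; apply/inje/(@perm_inj _ (wr_perm x)); rewrite !sP E.
exists (Wreath [ffun j => wr_base x (e j)] (perm injs)).
apply: wreath_ext => i; case: (boolP (i \in codom e)) => [/codomP[j ->]|ni].
- by rewrite wr_embed_perm permE.
- by rewrite wr_embed_perm_out ?(out i ni).1.
- by rewrite wr_embed_base ffunE.
- by rewrite wr_embed_base_out ?(out i ni).2.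
Qed.

End Embedding.

(** * Existence of elements of a given modified type *)

Section Existence.
Local Open Scope group_scope.
Variable gT : finGroupType.

(** The rotation of [l] points, with all labels trivial except one. *)
Lemma labelled_cycle l c : 0 < l -> exists f : 'I_l -> 'I_l, exists2 g : 'I_l -> gT,
  injective f & forall i, cycle_key f g i = (l, c).
Proof.
case: l => // l _; have [p pc] := class_of_surj c.
pose f := @ordS l.+1; pose g (i : 'I_l.+1) := if i == ord0 then p else 1.
have injf : injective f by exact: ordS_inj.
have itf m : m < l.+1 -> iter m f ord0 = m :> nat.
  elim: m => // m IH lm; rewrite iterS /= IH; last exact: ltnW.
  by rewrite modn_small.
have conn i : fconnect f ord0 i.
  have -> : i = iter i f ord0 by apply: val_inj; rewrite /= itf.
  exact: fconnect_iter.
have ord0E : forder f ord0 = l.+1.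
  by rewrite -[RHS]card_ord; apply: eq_card => i; rewrite !inE conn.
exists f, g => // i; rewrite (cycle_key_connect g injf (conn i)) cycle_keyE ord0E.
rewrite -pc /cycle_prod ord0E; congr (_, class_of _).
suff: forall m, m < l.+1 -> path_prod f g ord0 m.+1 = p by apply.
elim=> [|m IH] lm; rewrite path_prodS; first by rewrite path_prod0 mulg1 /= /g eqxx.
rewrite IH; last exact: ltnW.
have /negPf nz : iter m.+1 f ord0 != ord0 by rewrite -val_eqE [val _]itf.
by rewrite /g nz mul1g.
Qed.

(** The disjoint union of such cycles, for a list of keys. *)
Lemma labelled_cycles (L : seq (nat * conj_class gT)) : all (fun v => 0 < v.1) L ->
  exists T : finType, exists f : T -> T, exists2 g : T -> gT, injective f &
    #|T| = sumn (map fst L) /\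
    forall v, #|[set i | cycle_key f g i == v]| = (count_mem v L * v.1)%N.
Proof.
elim: L => [|v L IH] /=.
  move=> _; exists void, id, (fun=> 1) => //; split=> [|v]; first by rewrite card_void.
  by apply: eq_card0 => -[].
case/andP => vgt0 /IH[T [f [g injf [cT cP]]]].
have [f1 [g1 injf1 key1]] := labelled_cycle v.2 vgt0.
pose F (i : 'I_v.1 + T) := match i with inl a => inl (f1 a) | inr b => inr (f b) end.
pose G (i : 'I_v.1 + T) := match i with inl a => g1 a | inr b => g b end.
exists ('I_v.1 + T)%type, F, G; first by move=> [a|a] [b|b] //= [] => [/injf1->|/injf->].
split=> [|u]; first by rewrite card_sum card_ord cT.
have E1 a : cycle_key F G (inl a) = (v.1, v.2).
  rewrite -(key1 a); apply: (@cycle_key_transfer _ _ _ _ _ _ _ _ (fun=> 1)) => //.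
    by move=> ? ? [].
  by move=> i; rewrite /= mul1g invg1 mulg1.
have E2 b : cycle_key F G (inr b) = cycle_key f g b.
  apply: (@cycle_key_transfer _ _ _ _ _ _ _ _ (fun=> 1)) => //.
    by move=> ? ? [].
  by move=> i; rewrite /= mul1g invg1 mulg1.
rewrite -sum1_card big_mkcond big_sumType /= mulnDl -cP; congr (_ + _)%N.
  rewrite (eq_bigr (fun=> (v == u) : nat)); last first.
    by move=> a _; rewrite inE E1 -surjective_pairing; case: eqP.
  by rewrite sum_nat_const card_ord mulnC; case: eqP => [->|].
rewrite -sum1_card [RHS]big_mkcond /=; apply: eq_bigr => b _; by rewrite !inE E2.
Qed.

(** One cycle for each part of [nu], of length increased by 1 in the identity
    class, completed by trivial fixed points. *)
Lemma modified_type_exists (nu : ptype gT) n : class_sum_bound nu <= n ->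
  exists x : wreath gT n, modified_type x = nu.
Proof.
move=> le_n; pose len (c : conj_class gT) l := if c == class_id gT then l.+1 else l.
pose L := flatten [seq [seq (len c l, c) | l <- nu c] | c <- index_enum (conj_class gT)]
  ++ nseq (n - class_sum_bound nu) (trivial_key gT).
have nu0 c : 0%N \notin parts (nu c) by case: (nu c) => s /= /andP[].
have Lgt0 : all (fun v => 0 < v.1) L.
  rewrite all_cat all_nseq orbT andbT; apply/allP => v /flattenP[s /mapP[c _ ->]].
  move=> /mapP[l lnu ->] /=; rewrite /len; case: ifP => // _.
  by rewrite lt0n; apply: contraNneq (nu0 c) => <-.
have [T [f [g injf [cT cP]]]] := labelled_cycles Lgt0.
have {cT}cT : #|T| = n.
  rewrite cT map_cat sumn_cat map_nseq sumn_nseq mul1n -[RHS](subnKC le_n).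
  congr (_ + _)%N; rewrite map_flatten sumn_flatten -!map_comp sumnE big_map /=.
  rewrite /class_sum_bound /ptype_size [LHS](bigD1 (class_id gT)) //=.
  rewrite [X in _ = (X + _)%N](bigD1 (class_id gT)) //= addnAC; congr (_ + _)%N.
    rewrite -map_comp /= /len eqxx; elim: (parts _) => //= l s ->.
    by rewrite addSn addnS addnA.
  by apply: eq_bigr => c nc; rewrite -map_comp /= /len (negPf nc) map_id.
pose e (i : T) : 'I_n := cast_ord cT (enum_rank i).
have inje : injective e by move=> i j /cast_ord_inj/enum_rank_inj.
pose e' (i : 'I_n) : T := enum_val (cast_ord (esym cT) i).
have eK : cancel e e' by move=> i; rewrite /e' /e cast_ordK enum_rankK.
have eK' : cancel e' e by move=> i; rewrite /e' /e enum_valK cast_ordKV.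
have inj_efe : injective (e \o f \o e').
  by apply: inj_comp (can_inj eK'); apply: inj_comp.
pose x : wreath gT n := Wreath [ffun i => g (e' i)] (perm inj_efe).
exists x; apply: modified_type_keys => c l lgt0; rewrite -/(len c l) /=.
rewrite -[RHS]/(count_mem l (nu c) * (len c l, c).1)%N.
have keyE i : wr_key x (e i) = cycle_key f g i.
  apply: (@cycle_key_transfer _ _ _ _ _ _ _ _ (fun=> 1)) => // j.
    by rewrite permE /= eK.
  by rewrite ffunE eK /= mul1g invg1 mulg1.
transitivity #|[set i | cycle_key f g i == (len c l, c)]|.
  rewrite -[RHS](card_imset _ inje); apply: eq_card => i; rewrite -[i]eK'.
  by rewrite (mem_imset _ _ inje) !inE keyE.
rewrite cP; congr (_ * _)%N.
rewrite count_cat count_nseq /= [X in (_ + X)%N](_ : _ = 0%N) ?addn0; last first.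
  case: eqP => // -[]; rewrite /len => + ccid; rewrite ccid eqxx => -[l0].
  by rewrite -l0 in lgt0.
rewrite count_flatten sumnE big_map big_map /= (bigD1 c) //= big1 ?addn0.
  rewrite count_map; apply: eq_count => l' /=; rewrite xpair_eqE eqxx andbT /len.
  by case: ifP.
move=> c' nc; rewrite count_map; apply/eqP; rewrite -leqn0 leqNgt -has_count.
by apply/hasPn => l' _ /=; rewrite xpair_eqE (negPf nc) andbF.
Qed.

End Existence.

(** * Systems of equations u(j) = a u(i) and their ranks *)

Section GainFlats.
Local Open Scope group_scope.
Variables (gT : finGroupType) (T : finType).
Implicit Types (u w : {ffun T -> option gT}) (E D : seq (T * T * gT)).

(** The left action of the group on itself with a zero adjoined; [None] is the
    zero. *)
Definition gain (a : gT) (v : option gT) : option gT := omap (mulg a) v.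

Lemma gain1 v : gain 1 v = v.
Proof. by case: v => //= a; rewrite mul1g. Qed.

Lemma gainM a b v : gain (a * b) v = gain a (gain b v).
Proof. by case: v => //= c; rewrite mulgA. Qed.

Lemma gain_inj a : injective (gain a).
Proof. by move=> [b|] [c|] //= [/mulgI->]. Qed.

Lemma gain_eq a v : (v == gain a v) = (a == 1) || (v == None).
Proof.
case: v => [b|]; rewrite ?orbT //= orbF -{1}[b]mul1g.
apply/eqP/eqP => [[/mulIg <-] //|->//].
Qed.

(** The solutions of the equations u(j) = a u(i), for (i, j, a) in the list. *)
Definition sol E : {set {ffun T -> option gT}} :=
  [set u : {ffun T -> option gT} | all (fun ed => u ed.1.2 == gain ed.2 (u ed.1.1)) E].

(** The value at [i] of the function with the values of [u] at the roots: the
    rule [rho i = Some (r, a)] says that u(i) = a u(r), and [None] that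
    u(i) = 0. *)
Definition flat_eval (rho : T -> option (T * gT)) u i : option gT :=
  if rho i is Some (r, a) then gain a (u r) else None.

(** The functions that obey the rules [rho]. *)
Definition flat rho : {set {ffun T -> option gT}} :=
  [set u : {ffun T -> option gT} | [forall i, u i == flat_eval rho u i]].

(** The points where the value is free. *)
Definition flat_roots (rho : T -> option (T * gT)) : {set T} :=
  [set r | rho r == Some (r, 1)].

(** Every rule refers to a root. *)
Definition is_parametrization (rho : T -> option (T * gT)) :=
  forall i r a, rho i = Some (r, a) -> rho r = Some (r, 1).

(** [F] is freely parametrized by its values at [m] roots. *)
Definition has_rank (F : {set {ffun T -> option gT}}) (m : nat) :=
  exists rho, [/\ is_parametrization rho, F = flat rho & #|flat_roots rho| = m].

Lemma flatP rho u : reflect (forall i, u i = flat_eval rho u i) (u \in flat rho).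
Proof. rewrite inE; exact: eqfunP. Qed.

Lemma card_flat F m : has_rank F m -> (#|F| = #|gT|.+1 ^ m)%N.
Proof.
case=> rho [rhoP -> <-]; rewrite -card_option.
rewrite -(card_pffun_on None (flat_roots rho) (mem predT)).
pose ext u : {ffun T -> option gT} := [ffun i => flat_eval rho u i].
have extR u r : r \in flat_roots rho -> ext u r = u r.
  by rewrite inE ffunE /flat_eval => /eqP->; rewrite gain1.
have -> : flat rho = ext @: [set u in pffun_on None (mem (flat_roots rho)) (mem predT)].
  apply/setP => u; apply/idP/imsetP => [/flatP uP|[w _ ->]].
    exists [ffun i => if i \in flat_roots rho then u i else None].
      rewrite inE; apply/pffun_onP; split=> //; apply/subsetP => i.
      by apply: contraR => /negPf ni; rewrite ffunE ni.
    apply/ffunP => i; rewrite ffunE uP /flat_eval; case Ei: (rho i) => [[r a]|//].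
    by rewrite ffunE inE (rhoP _ _ _ Ei) eqxx.
  apply/flatP => i; rewrite {1}/ext ffunE /flat_eval; case Ei: (rho i) => [[r a]|//].
  by rewrite extR // inE (rhoP _ _ _ Ei).
rewrite card_in_imset ?cardsE // => u w; rewrite !inE => /pffun_onP[/subsetP su _] /pffun_onP[/subsetP sw _] E.
apply/ffunP => i; case: (boolP (i \in flat_roots rho)) => [ri|ni].
  by rewrite -(extR u _ ri) -(extR w _ ri) E.
have out v : {subset None.-support v <= mem (flat_roots rho)} -> v i = None.
  by move=> sv; apply/eqP; apply: contraR ni => vi; exact: sv vi.
by rewrite !out.
Qed.

Lemma has_rank_nil : has_rank (sol [::]) #|T|.
Proof.
exists (fun i => Some (i, 1)); split.
- by move=> i r a [<- _].
- by apply/setP => u; rewrite inE; apply/esym/flatP => i; rewrite /flat_eval gain1.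
- by apply: eq_card => i; rewrite !inE eqxx.
Qed.

(** The equation u(r) = 0 at a root removes this root. *)
Lemma has_rank_kill F m rho r : is_parametrization rho -> F = flat rho ->
    #|flat_roots rho| = m -> r \in flat_roots rho ->
  exists2 m', m = m'.+1 & has_rank (F :&: [set u : {ffun T -> option gT} | u r == None]) m'.
Proof.
move=> rhoP -> <- rr; exists #|flat_roots rho :\ r|; first by rewrite (cardsD1 r) rr.
have Er : rho r = Some (r, 1) by move: rr; rewrite inE => /eqP.
pose rho' i := if rho i is Some (s, a) then
  if s == r then None else Some (s, a) else None.
exists rho'; split.
- move=> i s a; rewrite /rho'; case Ei: (rho i) => [[s' a']|//].
  by case: eqVneq => // ns [<- _]; rewrite (rhoP _ _ _ Ei) (negPf ns).
- apply/setP => u; apply/setIP/flatP => [[/flatP uP +] i|uP].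
    rewrite inE => /eqP ur; rewrite uP /flat_eval /rho'; case: (rho i) => [[s a]|//].
    by case: eqP => // ->; rewrite ur.
  have ur : u r = None by rewrite uP /flat_eval /rho' Er eqxx.
  split; last by rewrite inE ur.
  apply/flatP => i; rewrite uP /flat_eval /rho'; case: (rho i) => [[s a]|//].
  by case: eqP => // ->; rewrite ur.
- apply: eq_card => i; rewrite !inE /rho'; case: (eqVneq i r) => [->|ni].
    by rewrite Er eqxx.
  case: (rho i) => [[s a]|//]; case: (eqVneq s r) => //= ->.
  by apply/esym/eqP => -[ri _]; rewrite ri eqxx in ni.
Qed.

(** The equation u(r) = b u(s) between two roots removes the root [r]. *)
Lemma has_rank_merge F m rho r s b : is_parametrization rho -> F = flat rho ->
    #|flat_roots rho| = m -> r \in flat_roots rho -> s \in flat_roots rho -> r != s ->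
  exists2 m', m = m'.+1 & has_rank (F :&: [set u : {ffun T -> option gT} | u r == gain b (u s)]) m'.
Proof.
move=> rhoP -> <- rr ss nrs; exists #|flat_roots rho :\ r|; first by rewrite (cardsD1 r) rr.
have Er : rho r = Some (r, 1) by move: rr; rewrite inE => /eqP.
have Es : rho s = Some (s, 1) by move: ss; rewrite inE => /eqP.
pose rho' i := if rho i is Some (t, a) then
  if t == r then Some (s, a * b) else Some (t, a) else None.
have Es' : rho' s = Some (s, 1) by rewrite /rho' Es eq_sym (negPf nrs).
exists rho'; split.
- move=> i t a; rewrite {1}/rho'; case Ei: (rho i) => [[t' a']|//].
  case: eqVneq => [_ [<- _] //|nt [<- _]].
  by rewrite /rho' (rhoP _ _ _ Ei) (negPf nt).
- apply/setP => u; apply/setIP/flatP => [[/flatP uP +] i|uP].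
    rewrite inE => /eqP ur; rewrite uP /flat_eval /rho'; case: (rho i) => [[t a]|//].
    by case: eqP => // ->; rewrite ur gainM.
  have ur : u r = gain b (u s) by rewrite uP /flat_eval /rho' Er eqxx mul1g.
  split; last by rewrite inE ur.
  apply/flatP => i; rewrite uP /flat_eval /rho'; case: (rho i) => [[t a]|//].
  by case: eqP => // ->; rewrite ur gainM.
- apply: eq_card => i; rewrite !inE /rho'; case: (eqVneq i r) => [->|ni].
    rewrite Er eqxx; apply/eqP => -[sr _]; by rewrite sr eqxx in nrs.
  case Ei: (rho i) => [[t a]|//]; case: (eqVneq t r) => //= Et; rewrite Et in Ei *.
  have -> : (Some (r, a) == Some (i, 1)) = false.
    by apply/eqP => -[ri _]; rewrite ri eqxx in ni.
  by apply/eqP => -[si _]; move: Ei; rewrite -si Es => -[sr _]; rewrite sr eqxx in nrs.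
Qed.

(** In terms of root values, an equation is void, or kills a root, or expresses
    one root value by another. *)
Lemma has_rank_edge F m i j a : has_rank F m ->
  F :&: [set u : {ffun T -> option gT} | u j == gain a (u i)] = F \/
  exists2 m', m = m'.+1 & has_rank (F :&: [set u : {ffun T -> option gT} | u j == gain a (u i)]) m'.
Proof.
case=> rho [rhoP EF Em].
have rewF (A B : {set {ffun T -> option gT}}) :
    (forall u, u \in F -> (u \in A) = (u \in B)) -> F :&: A = F :&: B.
  by move=> AB; apply/setP => u; rewrite !inE; case uF: (u \in F); rewrite //= AB.
have uE u k : u \in F -> u k = flat_eval rho u k by rewrite EF => /flatP.
have root_of k r b : rho k = Some (r, b) -> r \in flat_roots rho.
  by move/rhoP; rewrite inE => ->.
pose kill r := [set u : {ffun T -> option gT} | u r == None].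
case Ei: (rho i) => [[r b]|]; case Ej: (rho j) => [[s c]|].
- case: (eqVneq s r) => [Esr|nsr].
    (* The equation reads c u(s) = a b u(s), so u(s) = 0 unless c = a b. *)
    case: (eqVneq (c^-1 * a * b) 1) => [E1|n1].
      left; rewrite (rewF _ setT) ?setIT // => u uF.
      rewrite !inE [u i](uE u _ uF) [u j](uE u _ uF) /flat_eval Ei Ej Esr -gainM.
      have -> : a * b = c by apply: (mulgI c^-1); rewrite mulgA E1 mulVg.
      by rewrite eqxx.
    right; rewrite (rewF _ (kill s)); first exact: has_rank_kill (root_of _ _ _ Ej).
    move=> u uF; rewrite !inE [u i](uE u _ uF) [u j](uE u _ uF) /flat_eval Ei Ej Esr.
    by rewrite -gainM -[a * b](mulKVg c) gainM (inj_eq (@gain_inj c)) mulgA gain_eq (negPf n1).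
  right; rewrite (rewF _ [set u : {ffun T -> option gT} | u s == gain (c^-1 * (a * b)) (u r)]).
    exact: has_rank_merge (root_of _ _ _ Ej) (root_of _ _ _ Ei) nsr.
  move=> u uF; rewrite !inE [u i](uE u _ uF) [u j](uE u _ uF) /flat_eval Ei Ej.
  by rewrite -gainM -[a * b](mulKVg c) gainM (inj_eq (@gain_inj c)) mulKVg.
- right; rewrite (rewF _ (kill r)); first exact: has_rank_kill (root_of _ _ _ Ei).
  move=> u uF; rewrite !inE [u i](uE u _ uF) [u j](uE u _ uF) /flat_eval Ei Ej.
  by case: (u r).
- right; rewrite (rewF _ (kill s)); first exact: has_rank_kill (root_of _ _ _ Ej).
  move=> u uF; rewrite !inE [u i](uE u _ uF) [u j](uE u _ uF) /flat_eval Ei Ej.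
  by case: (u s).
- left; rewrite (rewF _ setT) ?setIT // => u uF.
  by rewrite !inE [u i](uE u _ uF) [u j](uE u _ uF) /flat_eval Ei Ej.
Qed.

Lemma sol_cons ed E : sol (ed :: E) = sol E :&: [set u : {ffun T -> option gT} | u ed.1.2 == gain ed.2 (u ed.1.1)].
Proof. by apply/setP => u; rewrite !inE andbC. Qed.

Lemma sol_cat E D : sol (E ++ D) = sol E :&: sol D.
Proof. by apply/setP => u; rewrite !inE all_cat. Qed.

Lemma sol_has_rank E : exists m, has_rank (sol E) m.
Proof.
elim: E => [|[[i j] a] E [m rk]]; first by exists #|T|; exact: has_rank_nil.
rewrite sol_cons; case: (has_rank_edge i j a rk) => /= [->|[m' _ rk']].
  by exists m.
by exists m'.
Qed.

Lemma sol_edge i j a E (H := [set u : {ffun T -> option gT} | u j == gain a (u i)]) :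
  sol E :&: H = sol E \/ (#|sol E| = #|gT|.+1 * #|sol E :&: H|)%N.
Proof.
have [m rk] := sol_has_rank E; case: (has_rank_edge i j a rk) => [|[m' Em rk']].
  by left.
by right; rewrite (card_flat rk) (card_flat rk') Em expnS.
Qed.

(** Submodularity of the rank: an equation that is not implied by [D] divides the
    number of solutions of [D] by exactly q, and that of [E ++ D] by at
    most q. *)
Lemma sol_submodular E D :
  (#|sol E| * #|sol D| <= #|gT|.+1 ^ #|T| * #|sol E :&: sol D|)%N.
Proof.
elim: D => [|[[i j] a] D IH].
  rewrite (card_flat has_rank_nil) mulnC.
  have -> : sol [::] = setT by apply/setP => u; rewrite !inE.
  by rewrite setIT.
rewrite sol_cons /=; set H := [set u | _].
have [Ed|Ed] := sol_edge i j a D; first by rewrite -/H in Ed; rewrite Ed.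
rewrite -/H in Ed; rewrite -(leq_pmul2l (ltn0Sn #|gT|)).
rewrite mulnCA -Ed; apply: leq_trans IH _; rewrite mulnCA leq_mul2l; apply/orP; right.
have := sol_edge i j a (E ++ D); rewrite sol_cat -/H setIA => -[->|->] //.
by rewrite leq_pmull.
Qed.

End GainFlats.

(** * Invariants of an element of the wreath product *)

Section FixedSolutions.
Local Open Scope group_scope.
Variables (gT : finGroupType) (T : finType) (f : T -> T) (g : T -> gT).
Hypothesis injf : injective f.

(** The functions carried to themselves along the arrows i -> f i of gain g(i). *)
Definition invariants : {set {ffun T -> option gT}} :=
  [set u : {ffun T -> option gT} | [forall i, u (f i) == gain (g i) (u i)]].

Lemma invariants_sol : invariants = sol [seq (i, f i, g i) | i <- enum T].
Proof.
apply/setP => u; rewrite !inE all_map; apply/forallP/allP => [uP i _|uP i].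
  exact: uP.
by apply: uP; rewrite mem_enum.
Qed.

Lemma invariants_iter u i k : u \in invariants ->
  u (iter k f i) = gain (path_prod f g i k) (u i).
Proof.
rewrite inE => /forallP uP; elim: k => [|k IH]; first by rewrite path_prod0 gain1.
by rewrite iterS (eqP (uP _)) IH path_prodS gainM.
Qed.

(** An invariant function is free at the root of each cycle with trivial product
    and vanishes on the other cycles. *)
Lemma card_invariants : (#|invariants| =
  #|gT|.+1 ^ #|[set r | (froot f r == r) && (cycle_prod f g r == 1%g)]|)%N.
Proof.
pose rho i := let r := froot f i in
  if cycle_prod f g r == 1 then Some (r, path_prod f g r (findex f r i)) else None.
have rr i : froot f (froot f i) = froot f i by rewrite (root_root (fconnect_sym injf)).
apply: card_flat; exists rho; split.
- move=> i r a; rewrite /rho; case: ifP => // pr [<- _].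
  by rewrite rr pr findex0 path_prod0.
- apply/setP => u; apply/idP/flatP => [uI i|uP].
    rewrite -[in LHS](connect_iter_root injf i) invariants_iter // /flat_eval /rho.
    case: ifP => // /negbT np; have := invariants_iter (froot f i) (forder f (froot f i)) uI.
    rewrite (iter_order injf) => /eqP; rewrite gain_eq (negPf np) /= => /eqP ->.
    by [].
  rewrite inE; apply/forallP => i; rewrite !uP /flat_eval /rho froot_step //.
  case: ifP => // pr; rewrite -gainM findex_root_step //.
  have gi : g i * path_prod f g (froot f i) (findex f (froot f i) i) =
      path_prod f g (froot f i) (findex f (froot f i) i).+1.
    by rewrite path_prodS connect_iter_root.
  rewrite gi; case: ltnP => // le; rewrite path_prod0.
  suff -> : (findex f (froot f i) i).+1 = forder f (froot f i).
    by rewrite -/(cycle_prod f g _) (eqP pr).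
  apply/eqP; rewrite eqn_leq le andbT; apply: findex_max.
  by rewrite (fconnect_sym injf) connect_root.
- apply: eq_card => r; rewrite !inE /rho; case: ifP => pr.
    apply/eqP/andP => [[Er _]|[/eqP Er _]]; first by move: pr; rewrite Er eqxx.
    by rewrite Er findex0 path_prod0.
  by apply/esym/negP => /andP[/eqP Er]; rewrite -{1}Er pr.
Qed.

End FixedSolutions.

Section LengthFunction.
Local Open Scope group_scope.
Variables (gT : finGroupType) (n : nat).
Implicit Types x y z : wreath gT n.

(** The functions fixed by the action (x u)(i) = x_i u(s^-1 i), where [s] is the
    permutation of [x]; the gain of the arrow i -> s(i) is the label at its
    target. *)
Definition wr_invariants x : {set {ffun 'I_n -> option gT}} :=
  invariants (wr_perm x) (wr_base x \o wr_perm x).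

Lemma wr_invariantsP x (u : {ffun 'I_n -> option gT}) :
  reflect (forall i, u (wr_perm x i) = gain (wr_base x (wr_perm x i)) (u i))
          (u \in wr_invariants x).
Proof. rewrite inE; exact: eqfunP. Qed.

(** The number of invariants is q^(n - ||lam||). *)
Lemma card_wr_invariants x :
  (#|wr_invariants x| * #|gT|.+1 ^ ptype_size (modified_type x) = #|gT|.+1 ^ n)%N.
Proof.
rewrite /wr_invariants (card_invariants _ (@perm_inj _ (wr_perm x))) -expnD addnC.
rewrite -[n in RHS](ptype_size_modified_type x); congr (_ ^ (_ + _))%N.
apply: eq_card => r; rewrite !inE; congr (_ && _).
have pathE i k : path_prod (wr_perm x) (wr_base x \o wr_perm x) i k =
    path_prod (wr_perm x) (wr_base x) (wr_perm x i) k.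
  elim: k => [|k IH]; rewrite ?path_prod0 // !path_prodS IH /=.
  by rewrite -iterS iterSr.
have -> : cycle_prod (wr_perm x) (wr_base x \o wr_perm x) r =
    cycle_prod (wr_perm x) (wr_base x) (wr_perm x r).
  by rewrite /cycle_prod pathE forder_step //; exact: perm_inj.
rewrite cycle_prod_step; last exact: perm_inj.
by rewrite -class_of_eq_id class_of_mulJ.
Qed.

Lemma wr_invariantsM y z : wr_invariants y :&: wr_invariants z \subset wr_invariants (y * z).
Proof.
apply/subsetP => u /setIP[/wr_invariantsP uy /wr_invariantsP uz].
by apply/wr_invariantsP => i; rewrite wr_permM uy uz -gainM wr_baseM.
Qed.

(** A point is outside the support when its indicator function is invariant. *)
Lemma wr_support_invariants x i :
  (i \notin wr_support x) = ([ffun j => if j == i then Some 1 else None] \in wr_invariants x).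
Proof.
rewrite inE negb_or !negbK; apply/andP/wr_invariantsP => [[/eqP si /eqP gi] j|uP].
  rewrite !ffunE -{1}si (inj_eq perm_inj); case: eqP => // ->.
  by rewrite si gi gain1.
have := uP i; rewrite !ffunE eqxx; case: eqP => // si [].
by rewrite si mulg1 => <-; rewrite eqxx.
Qed.

Lemma wr_supportM y z : wr_support (y * z) \subset wr_support y :|: wr_support z.
Proof.
apply/subsetP => i; apply: contraLR; rewrite in_setU negb_or.
rewrite !wr_support_invariants => /andP[iy iz].
by apply: (subsetP (wr_invariantsM y z)); rewrite inE iy.
Qed.

(** If lengths add up in a product, the supports add up too. *)
Lemma wr_support_additive y z :
    ptype_size (modified_type (y * z)) =
      (ptype_size (modified_type y) + ptype_size (modified_type z))%N ->
  wr_support y :|: wr_support z = wr_support (y * z).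
Proof.
move=> len; have E : wr_invariants y :&: wr_invariants z = wr_invariants (y * z).
  apply/eqP; rewrite eqEcard wr_invariantsM /=.
  have := @sol_submodular gT 'I_n.
  pose edges x := [seq (i, wr_perm x i, (wr_base x \o wr_perm x) i) | i <- enum 'I_n].
  move=> /(_ (edges y) (edges z)); rewrite -!invariants_sol card_ord.
  rewrite -/(wr_invariants y) -/(wr_invariants z).
  set A := #|wr_invariants y|; set B := #|wr_invariants z|; set C := #|_ :&: _|.
  have qgt0 k : 0 < #|gT|.+1 ^ k by rewrite expn_gt0.
  rewrite -(leq_pmul2r (qgt0 (ptype_size (modified_type y) + ptype_size (modified_type z))%N)).
  rewrite {1}expnD mulnACA !card_wr_invariants.
  rewrite -mulnA leq_pmul2l ?qgt0 // -len -(card_wr_invariants (y * z)).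
  by rewrite leq_pmul2r ?qgt0.
apply/eqP; rewrite eqEsubset wr_supportM andbT; apply/subsetP => i.
apply: contraLR; rewrite in_setU negb_or !wr_support_invariants -E => /setIP[iy iz].
by rewrite iy iz.
Qed.

End LengthFunction.

(** * Counting factorizations *)

Section Factorizations.
Local Open Scope group_scope.
Variables (gT : finGroupType) (lam mu nu : ptype gT).

(** The left factors [y] of the factorizations x = y z with [y] of modified type
    [lam] and [z] of modified type [mu]; their number is the coefficient of [x]
    in the product of the two class sums. *)
Definition factors n (x : wreath gT n) : {set wreath gT n} :=
  [set y | (modified_type y == lam) && (modified_type (y^-1 * x) == mu)].

(** The union of the supports of the two factors. *)
Definition factor_support n (x y : wreath gT n) : {set 'I_n} :=
  wr_support y :|: wr_support (y^-1 * x).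

(** The factorizations that involve exactly the points of [U]. *)
Definition factors_on n (x : wreath gT n) (U : {set 'I_n}) : {set wreath gT n} :=
  [set y in factors x | factor_support x y == U].

Lemma wr_support_factor n (x y : wreath gT n) : wr_support x \subset factor_support x y.
Proof. by have := wr_supportM y (y^-1 * x); rewrite mulKVg. Qed.

Lemma card_factors n (x : wreath gT n) :
  #|factors x| = \sum_(U : {set 'I_n} | wr_support x \subset U) #|factors_on x U|.
Proof.
rewrite -sum1_card (partition_big (factor_support x) (fun U : {set 'I_n} => wr_support x \subset U)) /=.
  by apply: eq_bigr => U _; rewrite sum1_card; apply: eq_card => y; rewrite [RHS]inE.
by move=> y _; exact: wr_support_factor.
Qed.

Lemma card_factorsJ n (x w : wreath gT n) :
  #|factors (x ^ w)| = #|factors x|.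
Proof.
rewrite -[RHS](card_imset _ (@conjg_inj _ w)); apply: eq_card => y.
rewrite -[y](conjgKV w) (mem_imset _ _ (@conjg_inj _ w)) !inE.
by rewrite -conjVg -conjMg !modified_typeJ.
Qed.

Lemma card_factors_fullJ n (x w : wreath gT n) :
  #|factors_on (x ^ w) setT| = #|factors_on x setT|.
Proof.
rewrite -[RHS](card_imset _ (@conjg_inj _ w)); apply: eq_card => y.
rewrite -[y](conjgKV w) (mem_imset _ _ (@conjg_inj _ w)); set z := y ^ w^-1.
rewrite !inE /factor_support -conjVg -conjMg !modified_typeJ; congr (_ && _).
rewrite (wr_supportJ z w) (wr_supportJ (z^-1 * x) w) -imsetU.
rewrite !eqEcard !subsetT /= card_imset //; exact: perm_inj.
Qed.

Lemma card_factors_on_embed k n (e : 'I_k -> 'I_n) (inje : injective e) (x : wreath gT k) :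
  #|factors_on (wr_embed inje x) (e @: setT)| = #|factors_on x setT|.
Proof.
rewrite -[RHS](card_imset _ (wr_embed_inj (inje := inje))); apply: eq_card => z.
have memE y : (wr_embed inje y \in factors_on (wr_embed inje x) (e @: setT)) =
    (y \in factors_on x setT).
  rewrite !inE /factor_support -wr_embedV -wr_embedM !modified_type_embed.
  by rewrite !wr_support_embed -imsetU (inj_eq (imset_inj inje)).
apply/idP/imsetP => [zU|[y yU ->]]; last by rewrite memE.
have [|y Ez] := @wr_embed_surj _ _ _ _ inje z.
  move: zU; rewrite inE => /andP[_ /eqP E]; apply/subsetP => i iz.
  have : i \in factor_support (wr_embed inje x) z by rewrite inE iz.
  by rewrite E => /imsetP[j _ ->]; exact: codom_f.
by exists y => //; rewrite -memE -Ez.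
Qed.

(** The number of factorizations involving all [k] points, of an element of
    modified type [nu]. It is 0 if there is no such element; otherwise the
    one chosen does not matter, by [card_factors_fullJ]. *)
Definition full_factor_count (k : nat) : nat :=
  if [pick x : wreath gT k | modified_type x == nu] is Some x
  then #|factors_on x setT| else 0%N.

Lemma card_factors_on n (x : wreath gT n) (U : {set 'I_n}) :
  modified_type x = nu -> wr_support x \subset U ->
  #|factors_on x U| = full_factor_count #|U|.
Proof.
move=> tx sU; pose e (j : 'I_#|U|) : 'I_n := enum_val j.
have inje : injective e by exact: enum_val_inj.
have eU : e @: setT = U.
  apply/setP => i; apply/imsetP/idP => [[j _ ->]|iU]; first exact: enum_valP.
  by exists (enum_rank_in iU i); rewrite // /e enum_rankK_in.
have [|y Ex] := @wr_embed_surj _ _ _ _ inje x.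
  by apply/subsetP => i /(subsetP sU); rewrite -{1}eU => /imsetP[j _ ->]; exact: codom_f.
have ty : modified_type y = nu by rewrite -tx Ex modified_type_embed.
have -> : #|factors_on x U| = #|factors_on y setT|.
  by rewrite -(card_factors_on_embed inje) -Ex eU.
rewrite /full_factor_count; case: pickP => [z /eqP tz|/(_ y)]; last by rewrite ty eqxx.
have [w ->] := modified_type_conjugate (etrans ty (esym tz)).
by rewrite card_factors_fullJ.
Qed.

(** The second part is where additivity of lengths makes the polynomial
    constant. *)
Lemma full_factor_count_gt0 k : 0 < full_factor_count k ->
  k <= class_sum_bound lam + class_sum_bound mu /\
  (ptype_size nu = (ptype_size lam + ptype_size mu)%N -> k = class_sum_bound nu).
Proof.
rewrite /full_factor_count; case: pickP => // x /eqP tx.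
case/card_gt0P => y; rewrite !inE => /andP[/andP[/eqP ty /eqP tz] /eqP full].
split=> [|len].
  rewrite -ty -tz -!card_wr_support -[X in X <= _](card_ord k) -cardsT -full.
  by rewrite cardsU leq_subr.
rewrite -tx -card_wr_support -[LHS](card_ord k) -cardsT -full.
by rewrite -[in RHS](mulKVg y x) -wr_support_additive // mulKVg tx ty tz.
Qed.

(** The sets containing [S] are S :|: W with W disjoint from [S]. *)
Lemma sum_supsets n (S : {set 'I_n}) (F : nat -> nat) B :
  (forall i, B < i -> F (#|S| + i)%N = 0%N) ->
  \sum_(U : {set 'I_n} | S \subset U) F #|U| =
    \sum_(i < B.+1) (F (#|S| + i) * 'C(n - #|S|, i))%N.
Proof.
move=> F0; rewrite (reindex_onto (fun W => S :|: W) (fun U => U :\: S)) /=; last first.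
  by move=> U SU; rewrite setDE setUIr setUCr setIT; apply/setUidPr.
have condE (W : {set 'I_n}) :
    (S \subset S :|: W) && ((S :|: W) :\: S == W) = (W \subset ~: S).
  rewrite subsetUl /= setDUl setDv set0U; apply/eqP/idP => [<-|WS].
    by rewrite setDE subsetIr.
  by rewrite setDE; apply/setIidPl.
rewrite (eq_bigl _ _ condE).
transitivity (\sum_(W : {set 'I_n} | W \subset ~: S)
    \sum_(i < B.+1 | i == #|W| :> nat) F (#|S| + i)%N).
  apply: eq_bigr => W WS.
  have -> : #|S :|: W| = (#|S| + #|W|)%N.
    rewrite cardsU (_ : S :&: W = set0) ?cards0 ?subn0 //.
    by apply/eqP; rewrite setI_eq0 disjoint_sym disjoints_subset.
  case: (leqP #|W| B) => leB.
    have ltB : #|W| < B.+1 by [].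
    by rewrite (big_pred1 (Ordinal ltB)).
  rewrite F0 // big1 // => i /eqP Ei; have := ltn_ord i.
  by rewrite Ei ltnS leqNgt leB.
rewrite (exchange_big_dep xpredT) //=; apply: eq_bigr => i _.
rewrite sum_nat_const mulnC; congr (_ * _)%N.
have -> : (n - #|S|)%N = #|~: S| by rewrite [RHS]cardsCs setCK card_ord.
rewrite -cards_draws.
by apply: eq_card => W; rewrite !inE unfold_in /= eq_sym.
Qed.

Lemma card_factors_binomial n (x : wreath gT n) (b := class_sum_bound nu) :
  modified_type x = nu ->
  #|factors x| =
    \sum_(i < (class_sum_bound lam + class_sum_bound mu).+1)
      (full_factor_count (b + i) * 'C(n - b, i))%N.
Proof.
move=> tx; rewrite card_factors /b -tx -card_wr_support -sum_supsets; last first.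
  move=> i ltBi; apply/eqP; rewrite -leqn0 leqNgt; apply/negP => /full_factor_count_gt0[].
  by rewrite leqNgt ltn_addl.
by apply: eq_bigr => U; apply: card_factors_on.
Qed.

End Factorizations.

(** * Structure constants as numbers of factorizations *)

Section Coefficients.
Import classical_sets fsbigop.
Local Open Scope ring_scope.
Variable gT : finGroupType.

Lemma group_ring_sumE (G : finGroupType) (I : Type) (r : seq I) (P : pred I)
    (F : I -> group_ring G) (x : G) :
  (\sum_(i <- r | P i) F i) x = \sum_(i <- r | P i) F i x.
Proof.
apply: (big_morph (fun a : group_ring G => a x)) => [a b|]; exact: ffunE.
Qed.

Lemma group_ring_mulzE (G : finGroupType) (a : group_ring G) (x : G) (z : int) :
  (a *~ z) x = a x * z.
Proof.
have mulrnE k : (a *+ k) x = a x *+ k.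
  by elim: k => [|k IH]; rewrite ?mulr0n ?mulrS [LHS]ffunE // IH.
case: z => k; first by rewrite -pmulrn mulrnE -mulr_natr natz.
by rewrite NegzE mulrNz -pmulrn [LHS]ffunE mulrnE mulrN -mulr_natr natz.
Qed.

Lemma class_sumE n (lam : ptype gT) (x : wreath gT n) :
  class_sum n lam x = (modified_type x == lam)%:R.
Proof.
rewrite /class_sum group_ring_sumE big_mkcond (bigD1 x) //= big1 ?addr0.
  by rewrite ffunE eqxx; case: eqP.
by move=> y nyx; case: ifP => // _; rewrite ffunE eq_sym (negPf nyx).
Qed.

Lemma class_sum_mulE n (lam mu : ptype gT) (x : wreath gT n) :
  (class_sum n lam * class_sum n mu) x = (#|factors lam mu x|)%:R.
Proof.
rewrite [LHS]ffunE -sum1_card natr_sum [RHS]big_mkcond; apply: eq_bigr => y _.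
by rewrite !class_sumE !inE; do 2!case: eqP => _; rewrite ?mulr1 ?mulr0.
Qed.

(** Only the types of elements of the wreath product on [n] points contribute. *)
Lemma class_sum_combinationE n (a : ptype gT -> int) (x : wreath gT n) :
  (\sum_(kap \in [set: ptype gT]%classic) class_sum n kap *~ a kap) x
    = a (modified_type x).
Proof.
pose r := undup [seq modified_type y | y : wreath gT n].
have mem_r (y : wreath gT n) : modified_type y \in r by rewrite mem_undup; apply/mapP; exists y; rewrite ?mem_enum.
rewrite (@fsbigE _ _ _ _ _ r) ?undup_uniq //; last first.
  move=> kap _ nkap; suff -> : class_sum n kap = 0 by rewrite mul0rz.
  apply/ffunP => y; rewrite class_sumE [RHS]ffunE.
  by case: eqP => // Ey; rewrite -Ey mem_r in nkap.
rewrite group_ring_sumE (eq_bigl xpredT) => [|kap]; last by rewrite in_setT.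
rewrite (bigD1_seq (modified_type x)) ?undup_uniq //=.
rewrite group_ring_mulzE class_sumE eqxx mul1r big1 ?addr0 //.
by move=> kap /negPf nk; rewrite group_ring_mulzE class_sumE eq_sym nk mul0r.
Qed.

(** The coefficient of a class sum that does not vanish is well defined. *)
Lemma structure_constantP n (lam mu nu : ptype gT) (x : wreath gT n) z :
  modified_type x = nu ->
  is_structure_constant n lam mu nu z <-> z = (#|factors lam mu x|)%:R.
Proof.
move=> tx; split=> [[a Ea <-]|->].
  by rewrite -tx -(class_sum_combinationE a) -Ea class_sum_mulE.
exists (fun kap => if [pick y : wreath gT n | modified_type y == kap] is Some y
                   then (#|factors lam mu y|)%:R else 0).
  apply/ffunP => y; rewrite class_sum_combinationE class_sum_mulE.
  case: pickP => [y' /eqP E|/(_ y)]; last by rewrite eqxx.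
  by have [w Ey] := modified_type_conjugate (esym E); rewrite Ey card_factorsJ.
case: pickP => [y /eqP E|/(_ x)]; last by rewrite tx eqxx.
by have [w Ey] := modified_type_conjugate (etrans tx (esym E)); rewrite Ey card_factorsJ.
Qed.

Lemma interpolatesP (lam mu nu : ptype gT) (f : {poly rat}) :
  interpolates_structure_constants lam mu nu f <->
  forall n (x : wreath gT n), (0 < n)%N -> modified_type x = nu ->
    f.[n%:R] = (#|factors lam mu x|)%:R.
Proof.
split=> [If n x n0 tx|If n n0 nb].
  have nb : (class_sum_bound nu <= n)%N.
    by rewrite -tx -card_wr_support -[n in (_ <= n)%N](card_ord n) max_card.
  have [z /(structure_constantP _ _ _ tx) -> ->] := If n n0 nb.
  by rewrite mulrz_nat.
have [x tx] := modified_type_exists nb.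
exists (#|factors lam mu x|)%:R; first exact/(structure_constantP _ _ _ tx).
by rewrite (If n x n0 tx) mulrz_nat.
Qed.

End Coefficients.

(** * The polynomial *)

Section Polynomials.
Local Open Scope ring_scope.

(** The polynomial X (X - 1) ... (X - j + 1) / j!. *)
Definition binomial_poly (j : nat) : {poly rat} :=
  (j`!%:R)^-1 *: \prod_(i < j) ('X - i%:R%:P).

Lemma horner_binomial_poly j m : (binomial_poly j).[m%:R] = 'C(m, j)%:R.
Proof.
have E : (\prod_(i < j) ('X - i%:R%:P : {poly rat})).[m%:R] = (m ^_ j)%:R.
  elim: j => [|j IH]; first by rewrite big_ord0 hornerC ffactn0.
  rewrite big_ord_recr hornerM IH hornerXsubC ffactnSr natrM.
  case: (leqP j m) => [le|lt]; first by rewrite natrB.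
  by rewrite ffact_small // !mul0r.
rewrite hornerZ E -bin_ffact natrM mulrC mulfK //.
by rewrite Num.Theory.pnatr_eq0 -lt0n fact_gt0.
Qed.

Lemma poly_eq_nat (f g : {poly rat}) b :
  (forall n, (b < n)%N -> f.[n%:R] = g.[n%:R]) -> f = g.
Proof.
move=> E; apply/eqP; rewrite -subr_eq0; apply/negPn/negP => nz.
pose rs : seq rat := [seq (b.+1 + i)%:R | i <- iota 0 (size (f - g))].
have := max_poly_roots nz (rs := rs); rewrite size_map size_iota ltnn => F.
suff: false by []; apply: F.
  apply/allP => _ /mapP[i _ ->]; rewrite rootE hornerD hornerN E ?subrr //.
  by rewrite addSn ltnS leq_addr.
rewrite map_inj_uniq ?iota_uniq // => i j /eqP.
by rewrite Num.Theory.eqr_nat eqn_add2l => /eqP.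
Qed.

(** The sum over i of M(b + i) C(X - b, i), with M the number of factorizations
    of full support and b the bound of [nu]. *)
Definition structure_poly gT (lam mu nu : ptype gT) : {poly rat} :=
  \sum_(i < (class_sum_bound lam + class_sum_bound mu).+1)
    (full_factor_count lam mu nu (class_sum_bound nu + i))%:R *:
      (binomial_poly i \Po ('X - (class_sum_bound nu)%:R%:P)).

Lemma structure_poly_interpolates gT (lam mu nu : ptype gT) :
  interpolates_structure_constants lam mu nu (structure_poly lam mu nu).
Proof.
apply/interpolatesP => n x _ tx; rewrite (card_factors_binomial lam mu tx).
have nb : (class_sum_bound nu <= n)%N.
  by rewrite -tx -card_wr_support -[n in (_ <= n)%N](card_ord n) max_card.
rewrite horner_sum natr_sum; apply: eq_bigr => i _.
by rewrite hornerZ horner_comp hornerXsubC -natrB // horner_binomial_poly natrM.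
Qed.

Lemma structure_poly_const gT (lam mu nu : ptype gT) :
  ptype_size nu = (ptype_size lam + ptype_size mu)%N ->
  structure_poly lam mu nu = (full_factor_count lam mu nu (class_sum_bound nu))%:R%:P.
Proof.
move=> len; rewrite /structure_poly big_ord_recl big1 ?addr0 => [|i _].
  rewrite addn0 /binomial_poly big_ord0 fact0 invr1 scale1r.
  by rewrite -polyC1 comp_polyC polyC1 alg_polyC.
suff -> : full_factor_count lam mu nu (class_sum_bound nu + lift ord0 i) = 0%N.
  by rewrite scale0r.
apply/eqP; rewrite -leqn0 leqNgt; apply/negP => /full_factor_count_gt0[_ /(_ len)/eqP].
by rewrite -[X in _ == X]addn0 eqn_add2l.
Qed.

End Polynomials.

Local Open Scope ring_scope.

Theorem theorem2p13 (gT : finGroupType) (lam mu nu : ptype gT) :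
  exists f : {poly rat},
    unique (interpolates_structure_constants lam mu nu) f /\
    (ptype_size nu = (ptype_size lam + ptype_size mu)%N ->
     exists c : rat, f = c%:P).
Proof.
exists (structure_poly lam mu nu); split; last first.
  by move=> len; exists (full_factor_count lam mu nu (class_sum_bound nu))%:R;
     exact: structure_poly_const.
split=> [|f /interpolatesP If]; first exact: structure_poly_interpolates.
have /interpolatesP Is := @structure_poly_interpolates gT lam mu nu.
apply: (@poly_eq_nat _ _ (class_sum_bound nu)) => n bn.
have [x tx] := modified_type_exists (ltnW bn).
by rewrite (If n x) ?(Is n x) // (leq_ltn_trans _ bn).
Qed.
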